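(* Let $\{X_t\}_{t\in\mathbb Z}$ be a strictly stationary, mean-zero functional time series in $L^2([0,1],\mathbb R)$ with spectral density operator $\mathscr F_\omega$, let $\hat{\mathscr F}^{(T)}_{\omega,\lambda}$ be the flat-top spectral density operator estimator, and let $\tilde{\mathscr F}^{(T)}_{\omega,\lambda}$ be the positive semi-definite operator estimator obtained from $\hat{\mathscr F}^{(T)}_{\omega,\lambda}$ by replacing its negative eigenvalues by zero. Then for each fixed $\omega$, $$\big\|\tilde{\mathscr F}^{(T)}_{\omega,\lambda}-\mathscr F_\omega\big\|_{HS}\le\big\|\hat{\mathscr F}^{(T)}_{\omega,\lambda}-\mathscr F_\omega\big\|_{HS},$$ where $\|\cdot\|_{HS}$ is the Hilbert–Schmidt norm.
   Context: Setting: $\{X_t(\tau);\tau\in[0,1]\}_{t\in\mathbb Z}$ is a strictly stationary sequence of random elements of $L^2([0,1],\mathbb R)$ with $\mathbb E X_t(\tau)=0$ for all $\tau$. The autocovariance kernel is $r_t(\tau,\sigma)=\mathbb E[X_{t+s}(\tau)X_s(\sigma)]$, assumed to satisfy $\sum_{t\in\mathbb Z}\|r_t\|_{L^2([0,1]^2)}<\infty$, and the spectral density kernel is $f_\omega(\tau,\sigma)=\frac1{2\pi}\sum_{t\in\mathbb Z}e^{-i\omega t}r_t(\tau,\sigma)$. Flat-top kernels: a flat-top function is $\lambda:\mathbb R\to[-1,1]$ with $\lambda(s)=1$ for $|s|\le c$ and $\lambda(s)=g(s)$ otherwise, where $c>0$ and $g:\mathbb R\to[-1,1]$ is symmetric,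 continuous at all but finitely many points, $g(c)=1$ and $\int_{\mathbb R}g^2<\infty$. The induced flat-top kernel is $\Lambda(x)=\frac1{2\pi}\int_{-\infty}^\infty\lambda(s)e^{isx}\,ds$. Estimator: given $X_0,\dots,X_{T-1}$ and a bandwidth $B_T>0$, the functional discrete Fourier transform is $\tilde X^{(T)}_\omega(\tau)=(2\pi T)^{-1/2}\sum_{t=0}^{T-1}X_t(\tau)e^{-i\omega t}$ and the periodogram kernel is $p^{(T)}_\omega(\tau,\sigma)=\tilde X^{(T)}_\omega(\tau)\tilde X^{(T)}_{-\omega}(\sigma)$. The flat-top estimator is $\hat f^{(T)}_{\omega,\lambda}(\tau,\sigma)=\frac{2\pi}T\sum_{s=1}^{T-1}W^{(T)}_\lambda\big(\omega-\frac{2\pi s}T\big)p^{(T)}_{2\pi s/T}(\tau,\sigma)$ with $W^{(T)}_\lambda(x)=\sum_{j\in\mathbb Z}\frac1{B_T}\Lambda\big(\frac{x+2\pi j}{B_T}\big)$ (real-valued). Operators: on $L^2([0,1],\mathbb C)$, $\mathscr F_\omega$ and $\hat{\mathscr F}^{(T)}_{\omega,\lambda}$ are the integral operators $h\mapsto\int_0^1f_\omega(\cdot,\sigma)h(\sigma)\,d\sigma$ and $h\mapsto\int_0^1\hat f^{(T)}_{\omega,\lambda}(\cdot,\sigma)h(\sigma)\,d\sigma$. Both are self-adjoint Hilbert–Schmidt operators and $\mathscr F_\omega$ is positive semi-definite. Write the spectral decomposition $\hat{\mathscr F}^{(T)}_{\omega,\lambda}(h)=\sum_{j\ge1}\hat\nu_j\langle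 h,\hat e_j\rangle\hat e_j$, where $(\hat\nu_j)$ is a real sequence tending to $0$ and $(\hat e_j)$ is an orthonormal basis. With $\tilde\nu_j=\max(\hat\nu_j,0)$, define $\tilde{\mathscr F}^{(T)}_{\omega,\lambda}(h)=\sum_{j\ge1}\tilde\nu_j\langle h,\hat e_j\rangle\hat e_j$. The inequality is between random variables, holding for every realization of the sample. *)

(* Defs.v *)
From HB Require Import structures.
From mathcomp Require Import all_boot all_order all_algebra.
From mathcomp Require Import complex.
From mathcomp Require Import all_classical all_reals all_analysis.

Set Implicit Arguments.
Unset Strict Implicit.
Unset Printing Implicit Defensive.

Import Order.TTheory GRing.Theory Num.Theory.
Import numFieldNormedType.Exports.

Local Open Scope classical_set_scope.
Local Open Scope ring_scope.
Local Open Scope complex_scope.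

(* Functions on [0,1] are represented by functions on R, considered under the
   Lebesgue measure restricted to [0,1]; values outside [0,1] are irrelevant. *)
Section unit_interval_measure.
Context (R : realType).

Lemma measurable_itv01 :
  measurable (`[0%R, 1%R]%classic : set (measurableTypeR R)).
Proof. exact: measurable_itv. Qed.

Lemma lebesgue_itv01_lty : (@lebesgue_measure R `[0%R, 1%R]%classic < +oo)%E.
Proof. by rewrite lebesgue_measure_itv/= lte_fin ltr01 oppr0 adde0 ltry. Qed.

Definition mu01 : set (measurableTypeR R) -> \bar R :=
  mfrestr measurable_itv01 lebesgue_itv01_lty.

HB.instance Definition _ := FiniteMeasure.copy mu01
  (mfrestr measurable_itv01 lebesgue_itv01_lty).

End unit_interval_measure.
Arguments mu01 : clear implicits.

(* Complex-valued functions: integrals and limits are taken componentwise. *)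
Section complex_valued.
Context (R : realType).

Definition cis (x : R) : R[i] := cos x +i* sin x.

Definition climn (u : nat -> R[i]) : R[i] :=
  limn (fun n => complex.Re (u n)) +i* limn (fun n => complex.Im (u n)).

(* The partial sum of u over |t| <= N. *)
Definition symsum (V : nmodType) (u : int -> V) (N : nat) : V :=
  \sum_(k < N.*2.+1) u (k%:Z - N%:Z).

Context d (T : measurableType d) (mu : {measure set T -> \bar R}).

Definition cintegral (D : set T) (f : T -> R[i]) : R[i] :=
  (\int[mu]_(x in D) complex.Re (f x)) +i* (\int[mu]_(x in D) complex.Im (f x)).

Definition L2C (f : T -> R[i]) : Prop :=
  (fun x => complex.Re (f x)) \in Lfun mu 2%:E /\
  (fun x => complex.Im (f x)) \in Lfun mu 2%:E.

Definition L2norm (f : T -> R[i]) : \bar R :=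
  'N[mu]_2%:E[(fun x => (Normc.normc (f x))%:E)].

End complex_valued.

Section L2_operators.
Context (R : realType).
Implicit Types (f g h : R -> R[i]) (e : nat -> R -> R[i]) (nu : nat -> R)
  (A : (R -> R[i]) -> R -> R[i]).

Definition inner f g : R[i] :=
  cintegral (mu01 R) setT (fun x => f x * (g x)^*).

(* h is the sum in L^2([0,1], C) of the series of the u j *)
Definition L2series (u : nat -> R -> R[i]) h : Prop :=
  (fun n => L2norm (mu01 R) (fun x => h x - \sum_(j < n) u j x)) @ \oo --> 0%E.

Definition orthonormal_basis e : Prop :=
  [/\ forall j, L2C (mu01 R) (e j),
      forall j k, inner (e j) (e k) = (j == k)%:R &
      forall h, L2C (mu01 R) h -> L2series (fun j x => inner h (e j) * e j x) h].

(* A h = \sum_j nu_j <h, e_j> e_j *)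
Definition diagonal_op nu e A : Prop :=
  forall h, L2C (mu01 R) h ->
    L2C (mu01 R) (A h) /\
    L2series (fun j x => (nu j)%:C * inner h (e j) * e j x) (A h).

Definition spectral_decomposition A nu e : Prop :=
  [/\ orthonormal_basis e, nu @ \oo --> (0 : R) & diagonal_op nu e A].

(* The value does not depend on the orthonormal basis b used to compute it. *)
Definition HSnorm (b : nat -> R -> R[i]) A : \bar R :=
  ((\sum_(0 <= j <oo) (L2norm (mu01 R) (A (b j)) ^+ 2)) `^ 2^-1)%E.

Definition integral_op (k : R * R -> R[i]) h : R -> R[i] :=
  fun tau => cintegral (mu01 R) setT (fun sigma => k (tau, sigma) * h sigma).

End L2_operators.

(* L^2([0,1], R), whose elements are functions rather than classes, with the
   Borel sigma-algebra of the L^2 seminorm; Borel sets are thus invariant under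
   almost-everywhere equality. *)
Section L2_random_elements.
Context (R : realType).

Definition L2R : Type := LfunType (mu01 R) (lee1n 2).
HB.instance Definition _ := Choice.copy L2R (LfunType (mu01 R) (lee1n 2)).
HB.instance Definition _ := isPointed.Build L2R (0 : LfunType (mu01 R) (lee1n 2)).

Definition L2R_fun (x : L2R) : R -> R :=
  fun tau => (x : LfunType (mu01 R) (lee1n 2)) tau.
Coercion L2R_fun : L2R >-> Funclass.

Definition L2_open : set (set L2R) :=
  [set U | forall x : L2R, U x -> exists2 eps : R, 0 < eps &
     forall y : L2R, ('N[mu01 R]_2%:E[(fun t => (y t - x t)%:E)] < eps%:E)%E -> U y].

Definition L2Borel := g_sigma_algebraType L2_open.

End L2_random_elements.

Section functional_time_series.
Context (R : realType) (d : measure_display) (Omega : measurableType d)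
  (P : probability Omega R).
Implicit Types (X : int -> Omega -> L2R R) (r : int -> R * R -> R).

Definition strictly_stationary X : Prop :=
  forall (n : nat) (t : 'I_n -> int) (s : int) (B : set (n.-tuple (L2Borel R))),
    measurable B ->
    P [set w | B [tuple (X (t i + s) w : L2Borel R) | i < n]] =
    P [set w | B [tuple (X (t i) w : L2Borel R) | i < n]].

(* Joint measurability makes pointwise moments meaningful; finiteness of the
   second moments is what the definition of the autocovariance kernel needs. *)
Definition functional_time_series X : Prop :=
  [/\ forall t, measurable_fun setT (X t : Omega -> L2Borel R),
      forall t, measurable_fun setT
        (fun z : Omega * measurableTypeR R => X t z.1 z.2),
      forall t tau, 0 <= tau <= 1 -> (fun w => X t w tau) \in Lfun P 2%:E &
      strictly_stationary X].

Definition mean_zero X : Prop :=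
  forall t tau, 0 <= tau <= 1 -> ('E_P[(fun w => X t w tau)] = 0)%E.

(* Stationarity of the L^2-valued process determines these expectations only
   up to a null set of pairs, whence the almost-everywhere equality. *)
Definition autocovariance_kernel X r : Prop :=
  forall t, measurable_fun setT (r t : measurableTypeR R * measurableTypeR R -> R) /\
    forall s, {ae (mu01 R \x mu01 R)%E, forall z : R * R,
      ('E_P[(fun w => X (t + s)%R w z.1 * X s w z.2)%R] = (r t z)%:E)%E}.

Definition summable_autocovariance r : Prop :=
  (\esum_(t in [set: int]) 'N[(mu01 R \x mu01 R)%E]_2%:E[EFin \o r t] < +oo)%E.

(* The series converges in L^2([0,1]^2), the mode of convergence given by
   the summability of the L^2 norms of the r_t. *)
Definition spectral_density_kernel r (omega : R) (f : R * R -> R[i]) : Prop :=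
  L2C (mu01 R \x mu01 R)%E f /\
  (fun N => L2norm (mu01 R \x mu01 R)%E (fun z => f z -
     ((2 * pi)^-1)%:C *
       symsum (fun t => cis (- (omega * t%:~R)) * (r t z)%:C) N)) @ \oo --> 0%E.

End functional_time_series.

Section flat_top_estimator.
Context (R : realType).
Implicit Types (lam : R -> R) (x : int -> R -> R).

Definition flat_top_function lam : Prop :=
  exists (c : R) (g : R -> R),
    [/\ 0 < c, forall s, -1 <= g s <= 1, forall s, g (- s) = g s,
        finite_set [set s | ~ {for s, continuous g}] & g c = 1] /\
    (\int[lebesgue_measure]_(s in [set: measurableTypeR R]) ((g s) ^+ 2)%:E
        < +oo)%E /\
    forall s, lam s = if `|s| <= c then 1 else g s.

(* lam is square-integrable but possibly not integrable, so that the integral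
   over R is the limit of the integrals over [-N, N]. *)
Definition flat_top_kernel lam (x : R) : R[i] :=
  ((2 * pi)^-1)%:C * climn (fun N : nat =>
    cintegral lebesgue_measure
      (`[- N%:R, N%:R]%classic : set (measurableTypeR R))
      (fun s => (lam s)%:C * cis (s * x))).

(* The series over Z need not converge absolutely either; its value is the
   limit of the symmetric partial sums. *)
Definition flat_top_weight lam (B x : R) : R[i] :=
  climn (symsum (fun j : int =>
    (B^-1)%:C * flat_top_kernel lam ((x + 2 * pi * j%:~R) / B))).

Definition fdft (T : nat) x (omega tau : R) : R[i] :=
  ((Num.sqrt (2 * pi * T%:R))^-1)%:C *
  \sum_(t < T) (x t%:Z tau)%:C * cis (- (omega * t%:R)).

Definition periodogram (T : nat) x (omega tau sigma : R) : R[i] :=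
  fdft T x omega tau * fdft T x (- omega) sigma.

Definition flat_top_estimator lam (B : R) (T : nat) x (omega : R)
    (z : R * R) : R[i] :=
  (2 * pi / T%:R)%:C *
  \sum_(1 <= s < T)
    flat_top_weight lam B (omega - 2 * pi * s%:R / T%:R) *
    periodogram T x (2 * pi * s%:R / T%:R) z.1 z.2.

End flat_top_estimator.

(* Main.v *)
(* Let K = tilde F - F and L = hat F - F. Both are self-adjoint, so by Parseval
   and Tonelli their Hilbert-Schmidt norms may be computed in the eigenbasis
   (e_k) of hat F instead of b. There
     |L e_k|^2 = nu_k^2 - 2 nu_k <F e_k, e_k> + |F e_k|^2,
   and likewise for K with max(nu_k, 0) in place of nu_k; since
   <F e_k, e_k> >= 0, this replacement does not increase the right-hand side.

   Positivity of F: <F h, h> is the limit of the Cesaro means of the partial sums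
   of the spectral series, and the N-th mean is a positive multiple of
   E |sum_(s < N) exp(-i omega s) <X_s, h>|^2. Since the forms are complex,
   self-adjointness of F follows from <F h, h> being real, by polarization. *)
From HB Require Import structures.
Require Import Defs.
From mathcomp Require Import all_boot all_order all_algebra.
From mathcomp Require Import complex.
From mathcomp Require Import all_classical all_reals all_analysis.
From mathcomp Require Import measurable_realfun.
From mathcomp Require Import ring lra.
Import Order.TTheory GRing.Theory Num.Theory.
Import numFieldNormedType.Exports.
Local Open Scope classical_set_scope.
Local Open Scope ring_scope.
Local Open Scope complex_scope.
Set Implicit Arguments.
Unset Strict Implicit.
Unset Printing Implicit Defensive.

(* On top of complex_scope, so that [^*] is uniformly Num.conj. *)
Local Open Scope ring_scope.

(** * Complex-valued integrals and L^2 *)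

(** Pointwise equations are rarely available: [r t] is tied to the moments only almost everywhere,
    [f] is an L^2 limit, and the value of a diagonal operator at e_k is nu_k e_k only as a class.
    Identities are therefore tested by inner products. In particular <F h, h> is read as the pairing
    of [f] with the kernel h(tau) conj h(sigma) on the square; Cauchy-Schwarz makes it continuous in
    [f]. Cesaro means enter because the symmetric partial sums need not give positive forms. The
    N-th mean weights lag t in proportion to N - |t|, the number of pairs s, u < N with s - u = t,
    and this is what lets the sum factor into a squared modulus. Exchanging the expectation with the
    integrals over [0,1]^2 requires X_t(tau) h(tau) to be square-integrable on Omega x [0,1];
    cutting h off secures this. *)

Section complex_parts.
Context (R : realType).
Implicit Types x y : R[i].

Lemma complexRI x y :
  complex.Re x = complex.Re y -> complex.Im x = complex.Im y -> x = y.
Proof. by case: x y => [a b] [c e] /= -> ->. Qed.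

Lemma ReD x y : complex.Re (x + y) = complex.Re x + complex.Re y.
Proof. by case: x y => [a b] [c e]. Qed.

Lemma ImD x y : complex.Im (x + y) = complex.Im x + complex.Im y.
Proof. by case: x y => [a b] [c e]. Qed.

Lemma ReN x : complex.Re (- x) = - complex.Re x.
Proof. by case: x. Qed.

Lemma ImN x : complex.Im (- x) = - complex.Im x.
Proof. by case: x. Qed.

Lemma ReB x y : complex.Re (x - y) = complex.Re x - complex.Re y.
Proof. by rewrite ReD ReN. Qed.

Lemma ImB x y : complex.Im (x - y) = complex.Im x - complex.Im y.
Proof. by rewrite ImD ImN. Qed.

Lemma ReM x y : complex.Re (x * y) =
  complex.Re x * complex.Re y - complex.Im x * complex.Im y.
Proof. by case: x y => [a b] [c e]. Qed.

Lemma ImM x y : complex.Im (x * y) =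
  complex.Re x * complex.Im y + complex.Im x * complex.Re y.
Proof. by case: x y => [a b] [c e]. Qed.

Lemma ReJ x : complex.Re x^* = complex.Re x.
Proof. by case: x. Qed.

Lemma ImJ x : complex.Im x^* = - complex.Im x.
Proof. by case: x. Qed.

Lemma Re_sum I (s : seq I) (P : pred I) (F : I -> R[i]) :
  complex.Re (\sum_(i <- s | P i) F i) = \sum_(i <- s | P i) complex.Re (F i).
Proof. by apply: (big_morph _ ReD). Qed.

Lemma Im_sum I (s : seq I) (P : pred I) (F : I -> R[i]) :
  complex.Im (\sum_(i <- s | P i) F i) = \sum_(i <- s | P i) complex.Im (F i).
Proof. by apply: (big_morph _ ImD). Qed.

Lemma conjcD x y : (x + y)^* = x^* + y^*.
Proof. exact: rmorphD. Qed.

Lemma conjcB x y : (x - y)^* = x^* - y^*.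
Proof. exact: rmorphB. Qed.

Lemma conjcM x y : (x * y)^* = x^* * y^*.
Proof. exact: rmorphM. Qed.

Lemma conj_sum I (s : seq I) (P : pred I) (F : I -> R[i]) :
  (\sum_(i <- s | P i) F i)^* = \sum_(i <- s | P i) (F i)^*.
Proof. exact: rmorph_sum. Qed.

Definition parts := (ReD, ImD, ReN, ImN, ReM, ImM, ReJ, ImJ).

Lemma sqr_normcE x :
  Normc.normc x ^+ 2 = complex.Re x ^+ 2 + complex.Im x ^+ 2.
Proof. by case: x => a b /=; rewrite sqr_sqrtr// addr_ge0// sqr_ge0. Qed.

Lemma normc_ge0 x : 0 <= Normc.normc x.
Proof. by case: x => a b; exact: sqrtr_ge0. Qed.

Lemma normcJE x : Normc.normc (x^*) = Normc.normc x.
Proof. by case: x => a b /=; rewrite sqrrN. Qed.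

Lemma normr_Re_le x : `|complex.Re x| <= Normc.normc x.
Proof.
by case: x => a b /=; rewrite -sqrtr_sqr ler_wsqrtr// lerDl sqr_ge0.
Qed.

End complex_parts.

Section complex_integral.
Context (R : realType) d (T : measurableType d).
Variable mu : {measure set T -> \bar R}.
Implicit Types (f g h : T -> R[i]) (c : R[i]).

Definition cmeasurable f :=
  measurable_fun setT (fun x => complex.Re (f x)) /\
  measurable_fun setT (fun x => complex.Im (f x)).

Definition cintegrable f :=
  mu.-integrable setT (fun x => (complex.Re (f x))%:E) /\
  mu.-integrable setT (fun x => (complex.Im (f x))%:E).

Local Notation "'I f" := (cintegral mu setT f) (at level 9, f at level 8).

Lemma eq_cintegral f g : f =1 g -> 'I f = 'I g.
Proof. by move=> /funext ->. Qed.

Lemma integrable_EFinD (u v : T -> R) :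
  mu.-integrable setT (EFin \o u) -> mu.-integrable setT (EFin \o v) ->
  mu.-integrable setT (fun x => (u x + v x)%:E).
Proof. by move=> iu iv; exact: (integrableD measurableT iu iv). Qed.

Lemma integrable_EFinZ (k : R) (u : T -> R) :
  mu.-integrable setT (EFin \o u) ->
  mu.-integrable setT (fun x => (k * u x)%:E).
Proof. by move=> iu; exact: (integrableZl measurableT k iu). Qed.

Lemma integrable_EFinN (u : T -> R) :
  mu.-integrable setT (EFin \o u) -> mu.-integrable setT (fun x => (- u x)%:E).
Proof. by move=> iu; exact: (integrableN iu). Qed.

Lemma integrable_EFinB (u v : T -> R) :
  mu.-integrable setT (EFin \o u) -> mu.-integrable setT (EFin \o v) ->
  mu.-integrable setT (fun x => (u x - v x)%:E).
Proof. by move=> iu iv; exact: (integrableB measurableT iu iv). Qed.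

Lemma cintegrableD f g : cintegrable f -> cintegrable g ->
  cintegrable (fun x => f x + g x).
Proof.
move=> [f1 f2] [g1 g2]; split.
- by under eq_fun do rewrite ReD; exact: integrable_EFinD.
- by under eq_fun do rewrite ImD; exact: integrable_EFinD.
Qed.

Lemma cintegrableZ c f : cintegrable f -> cintegrable (fun x => c * f x).
Proof.
move=> [f1 f2]; split.
- under eq_fun do rewrite ReM.
  by apply: integrable_EFinB; exact: integrable_EFinZ.
- under eq_fun do rewrite ImM.
  by apply: integrable_EFinD; exact: integrable_EFinZ.
Qed.

Lemma cintegrableJ f : cintegrable f -> cintegrable (fun x => (f x)^*).
Proof.
move=> [f1 f2]; split.
- by under eq_fun do rewrite ReJ.
- by under eq_fun do rewrite ImJ; exact: integrable_EFinN.
Qed.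

Lemma cintegrable0 : cintegrable (fun=> 0).
Proof. by split; exact: integrable0. Qed.

Lemma cintegralD f g : cintegrable f -> cintegrable g ->
  'I (fun x => f x + g x) = 'I f + 'I g.
Proof.
move=> [f1 f2] [g1 g2]; apply: complexRI; rewrite ?ReD ?ImD /=.
- by under eq_Rintegral do rewrite ReD; exact: RintegralD.
- by under eq_Rintegral do rewrite ImD; exact: RintegralD.
Qed.

Lemma cintegralZ c f : cintegrable f -> 'I (fun x => c * f x) = c * 'I f.
Proof.
move=> [f1 f2]; apply: complexRI; rewrite ?ReM ?ImM /=.
- under eq_Rintegral do rewrite ReM.
  by rewrite RintegralB ?RintegralZl//; exact: integrable_EFinZ.
- under eq_Rintegral do rewrite ImM.
  by rewrite RintegralD ?RintegralZl//; exact: integrable_EFinZ.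
Qed.

Lemma cintegralJ f : cintegrable f -> 'I (fun x => (f x)^*) = ('I f)^*.
Proof.
move=> [f1 f2]; apply: complexRI; rewrite ?ReJ ?ImJ /=.
- by under eq_Rintegral do rewrite ReJ.
- under eq_Rintegral do rewrite ImJ -mulN1r.
  by rewrite RintegralZl// mulN1r.
Qed.

Lemma cintegral0 : 'I (fun=> 0) = 0.
Proof. by rewrite /cintegral /= /Rintegral integral0. Qed.

Lemma cintegrable_sum I (s : seq I) (P : pred I) (F : I -> T -> R[i]) :
  (forall i, cintegrable (F i)) ->
  cintegrable (fun x => \sum_(i <- s | P i) F i x).
Proof.
move=> iF; elim: s => [|i s IH].
  by under eq_fun do rewrite big_nil; exact: cintegrable0.
under eq_fun do rewrite big_cons.
by case: (P i) => //; exact: cintegrableD.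
Qed.

Lemma cintegral_sum I (s : seq I) (P : pred I) (F : I -> T -> R[i]) :
  (forall i, cintegrable (F i)) ->
  'I (fun x => \sum_(i <- s | P i) F i x) = \sum_(i <- s | P i) 'I (F i).
Proof.
move=> iF; elim: s => [|i s IH].
  by under eq_cintegral do rewrite big_nil; rewrite cintegral0 big_nil.
under eq_cintegral do rewrite big_cons.
rewrite big_cons; case: (P i) => //.
by rewrite cintegralD ?IH//; exact: cintegrable_sum.
Qed.

End complex_integral.

(** * Square-integrable functions, the Hermitian pairing and Hoelder bounds *)

Section L2_functions.
Context (R : realType) d (T : measurableType d).
Variable mu : {measure set T -> \bar R}.
Implicit Types (u v : T -> R) (f g h : T -> R[i]) (c : R[i]).

(** Trades the L^2 seminorm for the integral of the square, to which Tonelli applies directly. *)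
Lemma Lfun2P u : u \in Lfun mu 2%:E <->
  measurable_fun setT u /\ (\int[mu]_x (u x ^+ 2)%:E < +oo)%E.
Proof.
have E : (\int[mu]_x (u x ^+ 2)%:E)%E = ('N[mu]_2%:E[EFin \o u] `^ 2)%E.
  rewrite poweR_Lnorm//; apply: eq_integral => x _ /=.
  by rewrite powR_mulrn// real_normK ?num_real.
rewrite E inE /Lfun; split.
  move=> /andP[]; rewrite !inE/= => mu_ nu; split => //.
  by apply: poweR_lty; exact: nu.
move=> [mu_ nu]; apply/andP; rewrite !inE/=; split => //.
exact: (lty_poweRy _ nu).
Qed.

Lemma Lfun2D u v : u \in Lfun mu 2%:E -> v \in Lfun mu 2%:E ->
  (fun x => u x + v x) \in Lfun mu 2%:E.
Proof. exact: (Lfun_addr_closed mu (lee1n 2)).2. Qed.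

Lemma Lfun2Z (k : R) u : u \in Lfun mu 2%:E ->
  (fun x => k * u x) \in Lfun mu 2%:E.
Proof.
move=> iu; have := Lfun_scale k (ler1n R 2) iu.
by under eq_fun do rewrite mulrC.
Qed.

Lemma Lfun2N u : u \in Lfun mu 2%:E -> (fun x => - u x) \in Lfun mu 2%:E.
Proof.
by move=> iu; under eq_fun do rewrite -mulN1r; exact: Lfun2Z.
Qed.

Lemma Lfun2_measurable u : u \in Lfun mu 2%:E -> measurable_fun setT u.
Proof. by move=> /Lfun2P[]. Qed.

Lemma Lfun2M_integrable u v : u \in Lfun mu 2%:E -> v \in Lfun mu 2%:E ->
  mu.-integrable setT (EFin \o (fun x => u x * v x)).
Proof.
by move=> iu iv; apply/Lfun1_integrable; exact: Lfun2_mul_Lfun1.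
Qed.

Lemma L2CD f g : L2C mu f -> L2C mu g -> L2C mu (fun x => f x + g x).
Proof.
move=> [f1 f2] [g1 g2]; split.
- by under eq_fun do rewrite ReD; exact: Lfun2D.
- by under eq_fun do rewrite ImD; exact: Lfun2D.
Qed.

Lemma L2CZ c f : L2C mu f -> L2C mu (fun x => c * f x).
Proof.
move=> [f1 f2]; split.
- by under eq_fun do rewrite ReM; apply: Lfun2D; [|apply: Lfun2N];
    exact: Lfun2Z.
- by under eq_fun do rewrite ImM; apply: Lfun2D; exact: Lfun2Z.
Qed.

Lemma L2CJ f : L2C mu f -> L2C mu (fun x => (f x)^*).
Proof.
move=> [f1 f2]; split.
- by under eq_fun do rewrite ReJ.
- by under eq_fun do rewrite ImJ; exact: Lfun2N.
Qed.

Lemma L2CN f : L2C mu f -> L2C mu (fun x => - f x).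
Proof. by move=> L2f; under eq_fun do rewrite -mulN1r; exact: L2CZ. Qed.

Lemma L2CB f g : L2C mu f -> L2C mu g -> L2C mu (fun x => f x - g x).
Proof. by move=> L2f L2g; apply: L2CD => //; exact: L2CN. Qed.

Lemma L2C0 : L2C mu (fun=> 0).
Proof.
have L0 : ((fun=> 0) : T -> R) \in Lfun mu 2%:E.
  apply/Lfun2P; split; first exact: measurable_cst.
  by rewrite integral0_eq// => x _; rewrite expr0n.
by split.
Qed.

Lemma L2C_sum I (s : seq I) (P : pred I) (F : I -> T -> R[i]) :
  (forall i, L2C mu (F i)) -> L2C mu (fun x => \sum_(i <- s | P i) F i x).
Proof.
move=> iF; elim: s => [|i s IH].
  by under eq_fun do rewrite big_nil; exact: L2C0.
by under eq_fun do rewrite big_cons; case: (P i) => //; exact: L2CD.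
Qed.

Lemma L2C_measurable f : L2C mu f -> cmeasurable f.
Proof. by move=> [f1 f2]; split; exact: Lfun2_measurable. Qed.

Lemma L2CM_integrable f g : L2C mu f -> L2C mu g ->
  cintegrable mu (fun x => f x * g x).
Proof.
move=> [f1 f2] [g1 g2]; split.
- by under eq_fun do rewrite ReM; apply: integrable_EFinB;
    exact: Lfun2M_integrable.
- by under eq_fun do rewrite ImM; apply: integrable_EFinD;
    exact: Lfun2M_integrable.
Qed.

Lemma measurable_normc f : cmeasurable f ->
  measurable_fun setT (fun x => Normc.normc (f x)).
Proof.
move=> [f1 f2].
have -> : (fun x => Normc.normc (f x)) =
    Num.sqrt \o (fun x => complex.Re (f x) ^+ 2 + complex.Im (f x) ^+ 2).
  apply/funext => x /=; rewrite -sqr_normcE.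
  by rewrite sqrtr_sqr ger0_norm ?normc_ge0.
apply: measurableT_comp.
  by apply: continuous_measurable_fun; exact: sqrt_continuous.
by apply: measurable_funD; apply: measurable_funX.
Qed.

(** Over a general measure: on [0,1] this is [inner], on the square it pairs kernels. *)
Definition cinner f g : R[i] := cintegral mu setT (fun x => f x * (g x)^*).

Definition sqnorm f : R := complex.Re (cinner f f).

Lemma cinnerDl f g h : L2C mu f -> L2C mu g -> L2C mu h ->
  cinner (fun x => f x + g x) h = cinner f h + cinner g h.
Proof.
move=> L2f L2g L2h; rewrite /cinner; under eq_cintegral do rewrite mulrDl.
by rewrite cintegralD//; apply: L2CM_integrable => //; exact: L2CJ.
Qed.

Lemma cinnerZl c f h : L2C mu f -> L2C mu h ->
  cinner (fun x => c * f x) h = c * cinner f h.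
Proof.
move=> L2f L2h; rewrite /cinner; under eq_cintegral do rewrite -mulrA.
by rewrite cintegralZ//; apply: L2CM_integrable => //; exact: L2CJ.
Qed.

Lemma cinnerC f g : L2C mu f -> L2C mu g -> cinner g f = (cinner f g)^*.
Proof.
move=> L2f L2g; rewrite /cinner -cintegralJ; last first.
  by apply: L2CM_integrable => //; exact: L2CJ.
by apply: eq_cintegral => x; rewrite conjcM conjCK mulrC.
Qed.

Lemma cinnerNl f h : L2C mu f -> L2C mu h ->
  cinner (fun x => - f x) h = - cinner f h.
Proof.
by move=> *; under [X in cinner X]eq_fun do rewrite -mulN1r;
  rewrite cinnerZl// mulN1r.
Qed.

Lemma cinnerBl f g h : L2C mu f -> L2C mu g -> L2C mu h ->
  cinner (fun x => f x - g x) h = cinner f h - cinner g h.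
Proof. by move=> *; rewrite cinnerDl ?cinnerNl//; exact: L2CN. Qed.

Lemma cinner_suml I (s : seq I) (P : pred I) (F : I -> T -> R[i]) h :
  (forall i, L2C mu (F i)) -> L2C mu h ->
  cinner (fun x => \sum_(i <- s | P i) F i x) h =
  \sum_(i <- s | P i) cinner (F i) h.
Proof.
move=> iF L2h; rewrite /cinner; under eq_cintegral do rewrite mulr_suml.
rewrite cintegral_sum// => i.
by apply: L2CM_integrable => //; exact: L2CJ.
Qed.

Lemma cinnerDr f g h : L2C mu f -> L2C mu g -> L2C mu h ->
  cinner h (fun x => f x + g x) = cinner h f + cinner h g.
Proof.
move=> L2f L2g L2h; rewrite cinnerC//; last exact: L2CD.
by rewrite cinnerDl// conjcD -cinnerC// -cinnerC.
Qed.

Lemma cinnerZr c f h : L2C mu f -> L2C mu h ->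
  cinner h (fun x => c * f x) = c^* * cinner h f.
Proof.
move=> L2f L2h; rewrite cinnerC//; last exact: L2CZ.
by rewrite cinnerZl// conjcM -cinnerC.
Qed.

Lemma cinnerBr f g h : L2C mu f -> L2C mu g -> L2C mu h ->
  cinner h (fun x => f x - g x) = cinner h f - cinner h g.
Proof.
move=> L2f L2g L2h; rewrite cinnerC//; last exact: L2CB.
by rewrite cinnerBl// conjcB -cinnerC// -cinnerC.
Qed.

(** The value +oo is allowed on both sides, since the identity is applied to all sections of a
    kernel, some of which may have infinite norm. *)
Lemma L2norm_sqr f :
  (L2norm mu f ^+ 2 = \int[mu]_x (Normc.normc (f x) ^+ 2)%:E)%E.
Proof.
transitivity ('N[mu]_2%:E[(fun x => (Normc.normc (f x))%:E)] `^ 2)%E.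
  rewrite /L2norm; have := Lnorm_ge0 mu 2%:E (fun x => (Normc.normc (f x))%:E).
  case: Lnorm => [r||]//; rewrite ?lee_fin => r0.
  - by rewrite poweR_EFin powR_mulrn// EFin_expe.
  - by rewrite poweRyr// expe2 mulyy.
rewrite poweR_Lnorm//; apply: eq_integral => x _ /=.
by rewrite powR_mulrn// ger0_norm ?normc_ge0.
Qed.

Lemma cinner_diag f x : f x * (f x)^* = (Normc.normc (f x) ^+ 2)%:C.
Proof.
by apply: complexRI; rewrite !parts /= ?sqr_normcE; ring.
Qed.

Lemma L2norm_sqrE f : L2C mu f -> (L2norm mu f ^+ 2)%E = (sqnorm f)%:E.
Proof.
move=> L2f; rewrite L2norm_sqr /sqnorm /cinner.
under eq_cintegral do rewrite cinner_diag.
rewrite /= /Rintegral fineK//.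
have [+ _] := L2CM_integrable L2f (L2CJ L2f).
under eq_fun do rewrite cinner_diag /=.
exact: integrable_fin_num.
Qed.

Lemma Im_cinner_diag f : complex.Im (cinner f f) = 0.
Proof.
rewrite /cinner; under eq_cintegral do rewrite cinner_diag.
by rewrite /= /Rintegral integral0_eq.
Qed.

Lemma sqnorm_ge0 f : 0 <= sqnorm f.
Proof.
rewrite /sqnorm /cinner; under eq_cintegral do rewrite cinner_diag.
by apply: Rintegral_ge0 => x _; exact: sqr_ge0.
Qed.

Lemma L2norm_fin f : L2C mu f -> L2norm mu f \is a fin_num.
Proof.
move=> /L2norm_sqrE; have := Lnorm_ge0 mu 2%:E (fun x => (Normc.normc (f x))%:E).
by rewrite -/(L2norm mu f); case: L2norm => //=; rewrite expe2 mulyy.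
Qed.

Lemma normr_fine_le (x : \bar R) : (`|fine x|%:E <= `|x|)%E.
Proof. by case: x => //= *; rewrite leey. Qed.

(** Measurability suffices because [fine] maps an infinite integral to 0; the bound then holds for
    every section of a kernel, not only for almost every one. *)
Lemma L2_hoelder (u : T -> R) f g :
  measurable_fun setT u -> cmeasurable f -> cmeasurable g ->
  (forall x, `|u x| <= Normc.normc (f x) * Normc.normc (g x)) ->
  (`|\int[mu]_x u x|%:E <= L2norm mu f * L2norm mu g)%E.
Proof.
move=> mu_ mf mg ufg; apply: (le_trans (normr_fine_le _)).
apply: le_trans; first by apply: le_abse_integral => //; exact/measurable_EFinP.
have := @hoelder _ _ _ mu (fun x => Normc.normc (f x)) (fun x => Normc.normc (g x))
  2 2 (measurable_normc mf) (measurable_normc mg) (ltr0Sn _ _) (ltr0Sn _ _).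
have -> : 2^-1 + 2^-1 = 1 :> R by lra.
move=> /(_ erefl); apply: le_trans; rewrite Lnorm1.
apply: ge0_le_integral => //=.
- by do 2 apply: measurableT_comp => //.
- do 2 apply: measurableT_comp => //.
  by apply: measurable_funM; exact: measurable_normc.
- move=> x _; rewrite lee_fin (le_trans (ufg x))//; exact: ler_norm.
Qed.

Lemma normr_Re_cintegral_le f g : cmeasurable f -> cmeasurable g ->
  (`|complex.Re (cintegral mu setT (fun x => f x * g x)%R)|%:E
     <= L2norm mu f * L2norm mu g)%E.
Proof.
move=> mf mg; apply: L2_hoelder => //.
- under eq_fun do rewrite ReM.
  move: mf mg => [? ?] [? ?].
  by apply: measurable_funB; apply: measurable_funM.
- move=> x; rewrite -Normc.normcM; exact: normr_Re_le.
Qed.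

Lemma normr_Im_cintegral_le f g : cmeasurable f -> cmeasurable g ->
  (`|complex.Im (cintegral mu setT (fun x => f x * g x)%R)|%:E
     <= L2norm mu f * L2norm mu g)%E.
Proof.
move=> mf mg; apply: L2_hoelder => //.
- under eq_fun do rewrite ImM.
  move: mf mg => [? ?] [? ?].
  by apply: measurable_funD; apply: measurable_funM.
- move=> x; rewrite -Normc.normcM.
  (* Multiplication by -i keeps the modulus and turns the imaginary part into a real part. *)
  have -> : complex.Im (f x * g x) = complex.Re (- 'i%C * (f x * g x)).
    by rewrite !parts /=; ring.
  apply: (le_trans (normr_Re_le _)).
  by rewrite [leLHS]Normc.normcM /= oppr0 sqrrN expr0n add0r expr1n sqrtr1 mul1r.
Qed.

End L2_functions.

(** * Orthonormal bases and Hilbert-Schmidt norms *)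

Section L2_convergence.
Context (R : realType) d (T : measurableType d).
Variable mu : {measure set T -> \bar R}.
Implicit Types (f g h : T -> R[i]) (v : nat -> T -> R[i]).

Lemma L2normJ f : L2norm mu (fun x => (f x)^*) = L2norm mu f.
Proof. by rewrite /L2norm; under eq_fun do rewrite normcJE. Qed.

Lemma sqnorm_cvg0 v : (forall n, L2C mu (v n)) ->
  (fun n => L2norm mu (v n)) @ \oo --> 0%E -> sqnorm mu (v n) @[n --> \oo] --> 0.
Proof.
move=> L2v /fine_cvg v0.
have -> : (fun n => sqnorm mu (v n)) =
    (fun n => fine (L2norm mu (v n)) * fine (L2norm mu (v n))).
  apply/funext => n; apply: EFin_inj.
  by rewrite -L2norm_sqrE// EFinM fineK ?L2norm_fin// expe2.
by rewrite -[X in _ --> X](mulr0 0); exact: cvgM.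
Qed.

(** Cauchy-Schwarz with the second factor fixed. This continuity is what carries both basis
    expansions and the spectral series through inner products. *)
Lemma cinner_cvg0 v g : (forall n, L2C mu (v n)) -> L2C mu g ->
  (fun n => L2norm mu (v n)) @ \oo --> 0%E ->
  complex.Re (cinner mu (v n) g) @[n --> \oo] --> 0 /\
  complex.Im (cinner mu (v n) g) @[n --> \oo] --> 0.
Proof.
move=> L2v L2g /fine_cvg v0.
have u0 : fine (L2norm mu (v n)) * fine (L2norm mu g) @[n --> \oo] --> 0.
  by rewrite -[X in _ --> X](mul0r (fine (L2norm mu g))); apply: cvgMr_tmp.
have main (w : nat -> R) :
    (forall n, (`|w n|%:E <= L2norm mu (v n) * L2norm mu g)%E) ->
    w n @[n --> \oo] --> 0.
  move=> wb; apply: norm_cvg0; apply: squeeze_cvgr u0; last exact: cvg_cst.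
  apply: nearW => n; rewrite normr_ge0/= -lee_fin EFinM.
  by rewrite !fineK ?L2norm_fin.
have mJ := L2C_measurable (L2CJ L2g).
split; apply: main => n; rewrite -[L2norm mu g]L2normJ.
- by apply: normr_Re_cintegral_le => //; exact: L2C_measurable.
- by apply: normr_Im_cintegral_le => //; exact: L2C_measurable.
Qed.

End L2_convergence.

Section orthonormal_bases.
Context (R : realType).
Local Notation m := (mu01 R).
Implicit Types (f g h : R -> R[i]) (u e b : nat -> R -> R[i]) (nu : nat -> R)
  (A : (R -> R[i]) -> R -> R[i]).

Lemma innerE f g : inner f g = cinner m f g. Proof. by []. Qed.

(** Pairing with [g] commutes with the series by continuity. The threshold [N] serves the diagonal
    expansions below, where orthonormality leaves the single term of index k, present from n = k + 1
    on. *)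
Lemma L2series_inner u h g l N :
  (forall j, L2C m (u j)) -> L2C m h -> L2C m g -> L2series u h ->
  (forall n, (N <= n)%N -> \sum_(j < n) inner (u j) g = l) -> inner h g = l.
Proof.
move=> L2u L2h L2g uh ul.
have L2S n : L2C m (fun x => h x - \sum_(j < n) u j x).
  by apply: L2CB => //; exact: L2C_sum.
have [re im] := cinner_cvg0 L2S L2g uh.
have E n : (N <= n)%N ->
    cinner m (fun x => h x - \sum_(j < n) u j x) g = inner h g - l.
  by move=> Nn; rewrite cinnerBl ?cinner_suml// ?ul//; exact: L2C_sum.
apply/eqP; rewrite -subr_eq0; apply/eqP; apply: complexRI => /=.
- apply/esym/(cvg_unique _ re) => //.
  apply: cvg_near_cst; near=> n; rewrite E//; near: n; exact: nbhs_infty_ge.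
- apply/esym/(cvg_unique _ im) => //.
  apply: cvg_near_cst; near=> n; rewrite E//; near: n; exact: nbhs_infty_ge.
Unshelve. all: by end_near. Qed.

Lemma orthonormal_basisJ e : orthonormal_basis e ->
  forall h k, L2C m h -> inner (e k) h = (inner h (e k))^*.
Proof. by move=> [L2e _ _] h k L2h; rewrite !innerE -cinnerC. Qed.

(** Pythagoras: the partial sum [S n] is orthogonal to the remainder, so the squared norm of the
    remainder is that of [h] minus the first n squared coefficients, and completeness sends it to
    0. *)
Lemma parseval e h : orthonormal_basis e -> L2C m h ->
  (\sum_(0 <= j <oo) (Normc.normc (inner h (e j)) ^+ 2)%:E =
   L2norm m h ^+ 2)%E.
Proof.
move=> onb L2h; have [L2e ee hs] := onb.
pose S n x := \sum_(j < n) inner h (e j) * e j x.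
have L2S n : L2C m (S n) by apply: L2C_sum => j; exact: L2CZ.
have L2D n : L2C m (fun x => h x - S n x) by exact: L2CB.
have SE n g : L2C m g ->
    cinner m (S n) g = \sum_(j < n) inner h (e j) * inner (e j) g.
  move=> L2g; rewrite cinner_suml//; last by move=> j; exact: L2CZ.
  by apply: eq_bigr => j _; rewrite cinnerZl.
have Se n (k : 'I_n) : cinner m (S n) (e k) = inner h (e k).
  rewrite SE// (bigD1 k)//= ee eqxx mulr1 big1 ?addr0// => j jk.
  by rewrite ee val_eqE (negbTE jk) mulr0.
have DS n : cinner m (S n) (fun x => h x - S n x) = 0.
  rewrite SE// big1// => j _; rewrite (innerE (e j)) (cinnerC (L2D n))//.
  by rewrite cinnerBl// Se -innerE subrr conjC0 mulr0.
have sqD n : sqnorm m (fun x => h x - S n x) =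
    sqnorm m h - \sum_(0 <= j < n) Normc.normc (inner h (e j)) ^+ 2.
  rewrite /sqnorm [X in complex.Re X = _]cinnerBl// DS subr0 cinnerBr//.
  rewrite !parts; congr (_ - _).
  rewrite cinnerC// ReJ SE// Re_sum big_mkord; apply: eq_bigr => j _.
  by rewrite orthonormal_basisJ// sqr_normcE !parts; ring.
have /cvg_lim <- // : (fun n => \sum_(0 <= j < n)
    (Normc.normc (inner h (e j)) ^+ 2)%:E)%E @ \oo --> (L2norm m h ^+ 2)%E.
rewrite L2norm_sqrE//.
under eq_fun do rewrite sumEFin.
apply/fine_cvgP; split; first exact: nearW.
have := sqnorm_cvg0 L2D (hs _ L2h).
under eq_fun do rewrite sqD.
move=> D0.
have -> : fine \o (fun n =>
      (\sum_(0 <= j < n) Normc.normc (inner h (e j)) ^+ 2)%:E) =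
    (fun n => sqnorm m h -
      (sqnorm m h - \sum_(0 <= j < n) Normc.normc (inner h (e j)) ^+ 2)).
  by apply/funext => n /=; rewrite subKr.
have := cvgB (cvg_cst (sqnorm m h)) D0; rewrite subr0; exact.
Qed.

Lemma diagonal_op_inner nu e A h k : orthonormal_basis e ->
  diagonal_op nu e A -> L2C m h ->
  inner (A h) (e k) = (nu k)%:C%C * inner h (e k).
Proof.
move=> [L2e ee _] dA L2h; have [L2Ah Ahs] := dA _ L2h.
apply: (L2series_inner (N := k.+1) _ L2Ah (L2e k) Ahs).
  by move=> j; exact: L2CZ.
move=> n kn; rewrite (bigD1 (Ordinal kn))//= innerE cinnerZl// -innerE ee eqxx.
rewrite mulr1 big1 ?addr0// => j jk; rewrite innerE cinnerZl// -innerE ee.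
by rewrite (_ : (j == k :> nat) = false) ?mulr0//; exact: negbTE.
Qed.

(** [A (e k)] is a multiple of [e k] only up to a null set, so the eigenvalue equation is stated
    against a test function. With [diagonal_op_inner] it gives the symmetry of [A] relative to the
    basis, as [nu k] is real. *)
Lemma diagonal_op_basis nu e A g k : orthonormal_basis e ->
  diagonal_op nu e A -> L2C m g ->
  inner (A (e k)) g = (nu k)%:C%C * inner (e k) g.
Proof.
move=> [L2e ee _] dA L2g; have [L2Ae Aes] := dA _ (L2e k).
apply: (L2series_inner (N := k.+1) _ L2Ae L2g Aes).
  by move=> j; exact: L2CZ.
move=> n kn; rewrite (bigD1 (Ordinal kn))//= innerE cinnerZl// -innerE ee eqxx.
rewrite mulr1 big1 ?addr0// => j jk; rewrite innerE cinnerZl// -innerE ee.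
by rewrite eq_sym (_ : (j == k :> nat) = false) ?mulr0 ?mul0r//; exact: negbTE.
Qed.

(* Parseval in both bases and Tonelli for the double series. *)
Lemma eq_HSnorm A b e : orthonormal_basis b -> orthonormal_basis e ->
  (forall h, L2C m h -> L2C m (A h)) ->
  (forall h k, L2C m h -> inner (A h) (e k) = (inner (A (e k)) h)^*) ->
  HSnorm b A = HSnorm e A.
Proof.
move=> onb one L2A Asym; have [[L2b _ _] [L2e _ _]] := (onb, one).
rewrite /HSnorm; congr (_ `^ _)%E.
under eq_eseriesr do rewrite -(parseval one (L2A _ (L2b _))).
under [RHS]eq_eseriesr do rewrite -(parseval onb (L2A _ (L2e _))).
rewrite nneseries_interchange; last by move=> *; rewrite lee_fin sqr_ge0.
apply: eq_eseriesr => k _; apply: eq_eseriesr => j _.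
by rewrite Asym// normcJE.
Qed.

Lemma sqnorm_diagonal_opB nu e A g k : orthonormal_basis e ->
  diagonal_op nu e A -> L2C m g ->
  sqnorm m (fun x => A (e k) x - g x) =
  nu k ^+ 2 - 2 * nu k * complex.Re (inner g (e k)) + sqnorm m g.
Proof.
move=> onb dA L2g; have [L2e ee _] := onb.
have [L2Ae _] := dA _ (L2e k).
rewrite /sqnorm cinnerBl//; last exact: L2CB.
rewrite (cinnerBr _ _ L2Ae)// (cinnerBr _ _ L2g)//.
rewrite -(innerE (A (e k))) (diagonal_op_basis _ onb dA)//.
rewrite (orthonormal_basisJ onb)// (diagonal_op_inner _ onb dA)//.
rewrite ee eqxx -(innerE (A (e k)) g) (diagonal_op_basis _ onb dA)//.
rewrite (cinnerC L2Ae L2g) -innerE (diagonal_op_basis _ onb dA)//.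
by rewrite (orthonormal_basisJ onb)// !parts /=; ring.
Qed.

Lemma le_HSnorm A A' e :
  (forall k, (L2norm m (A (e k)) ^+ 2 <= L2norm m (A' (e k)) ^+ 2)%E) ->
  (HSnorm e A <= HSnorm e A')%E.
Proof.
move=> AA'; have s0 B : (0 <= \sum_(0 <= j <oo) L2norm m (B (e j)) ^+ 2)%E.
  by apply: nneseries_ge0 => j _ _; rewrite expe_ge0// Lnorm_ge0.
rewrite /HSnorm gt0_ler_poweR ?in_itv/= ?leey ?s0//.
apply: lee_nneseries => [j _ _|j _]; last exact: AA'.
by rewrite mule_ge0// Lnorm_ge0.
Qed.

End orthonormal_bases.

(** * Product measures and integral operators *)

Section Rintegral_product.
Context (R : realType) d1 d2 (T1 : measurableType d1) (T2 : measurableType d2).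
Variables (m1 : {sigma_finite_measure set T1 -> \bar R})
  (m2 : {sigma_finite_measure set T2 -> \bar R}).

(** Meant for integrals over sections, which may be infinite on a null set: [fine] puts 0 there, and
    integrability survives. *)
Lemma integrable_fine d (T : measurableType d) (mu : {measure set T -> \bar R})
    (F : T -> \bar R) :
  mu.-integrable setT F -> mu.-integrable setT (EFin \o fine \o F).
Proof.
move=> iF; apply: le_integrable (iF) => //.
- apply/measurable_EFinP/measurableT_comp => //; exact: measurable_int iF.
- by move=> x _; exact: (normr_fine_le (F x)).
Qed.

Lemma Rintegral_fine d (T : measurableType d) (mu : {measure set T -> \bar R})
    (F : T -> \bar R) :
  mu.-integrable setT F -> \int[mu]_x fine (F x) = fine (\int[mu]_x F x)%E.
Proof.
move=> iF; congr fine; apply: ae_eq_integral => //.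
- exact: measurable_int (integrable_fine iF).
- exact: measurable_int iF.
- have := integrable_ae measurableT iF; apply: filterS => x /= Fx _.
  by rewrite fineK// Fx.
Qed.

Lemma integrable_fubini_G (F : T1 * T2 -> \bar R) :
  (m1 \x m2)%E.-integrable setT F -> m2.-integrable setT (fubini_G m1 F).
Proof.
move=> iF; have mF := measurable_int _ iF; have mG := measurable_fubini_G iF.
apply/integrableP; split => //.
apply: le_lt_trans ((integrable21ltyP m1 m2 mF).1 iF).
apply: ge0_le_integral => //.
- exact: measurableT_comp.
- apply: (measurable_fun_fubini_tonelli_G (abse \o F)) => //=.
  exact: measurableT_comp.
- by move=> y _; apply: le_abse_integral => //; exact: measurableT_comp.
Qed.

Section integrable_kernel.
Variable k : T1 * T2 -> R.
Hypothesis ik : (m1 \x m2)%E.-integrable setT (EFin \o k).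

Lemma integrable_Rintegral1 :
  m1.-integrable setT (EFin \o (fun x => \int[m2]_y k (x, y))).
Proof. exact: integrable_fine (integrable_fubini_F ik). Qed.

Lemma integrable_Rintegral2 :
  m2.-integrable setT (EFin \o (fun y => \int[m1]_x k (x, y))).
Proof. exact: integrable_fine (integrable_fubini_G ik). Qed.

Lemma Rintegral_prod1 :
  \int[m1]_x (\int[m2]_y k (x, y)) = \int[(m1 \x m2)%E]_z k z.
Proof.
rewrite [LHS](Rintegral_fine (integrable_fubini_F ik)).
by rewrite /Rintegral -integral12_prod_meas1.
Qed.

Lemma Rintegral_prod2 :
  \int[m2]_y (\int[m1]_x k (x, y)) = \int[(m1 \x m2)%E]_z k z.
Proof.
rewrite [LHS](Rintegral_fine (integrable_fubini_G ik)).
by rewrite /Rintegral -integral21_prod_meas1.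
Qed.

End integrable_kernel.

Lemma cintegral_prod1 (k : T1 * T2 -> R[i]) : cintegrable (m1 \x m2)%E k ->
  cintegral m1 setT (fun x => cintegral m2 setT (fun y => k (x, y))) =
  cintegral (m1 \x m2)%E setT k.
Proof.
move=> [k1 k2]; apply: complexRI => /=.
- exact: (@Rintegral_prod1 (fun z => complex.Re (k z))).
- exact: (@Rintegral_prod1 (fun z => complex.Im (k z))).
Qed.

Lemma cintegral_prod2 (k : T1 * T2 -> R[i]) : cintegrable (m1 \x m2)%E k ->
  cintegral m2 setT (fun y => cintegral m1 setT (fun x => k (x, y))) =
  cintegral (m1 \x m2)%E setT k.
Proof.
move=> [k1 k2]; apply: complexRI => /=.
- exact: (@Rintegral_prod2 (fun z => complex.Re (k z))).
- exact: (@Rintegral_prod2 (fun z => complex.Im (k z))).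
Qed.

Lemma cintegrable1 (k : T1 * T2 -> R[i]) : cintegrable (m1 \x m2)%E k ->
  cintegrable m1 (fun x => cintegral m2 setT (fun y => k (x, y))).
Proof.
move=> [k1 k2]; split => /=.
- exact: (@integrable_Rintegral1 (fun z => complex.Re (k z))).
- exact: (@integrable_Rintegral1 (fun z => complex.Im (k z))).
Qed.

Lemma cintegrable2 (k : T1 * T2 -> R[i]) : cintegrable (m1 \x m2)%E k ->
  cintegrable m2 (fun y => cintegral m1 setT (fun x => k (x, y))).
Proof.
move=> [k1 k2]; split => /=.
- exact: (@integrable_Rintegral2 (fun z => complex.Re (k z))).
- exact: (@integrable_Rintegral2 (fun z => complex.Im (k z))).
Qed.

Lemma ae_cintegrable1 (k : T1 * T2 -> R[i]) : cintegrable (m1 \x m2)%E k ->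
  {ae m1, forall x, cintegrable m2 (fun y => k (x, y))}.
Proof.
by move=> [k1 k2]; have := ae_integrable1 k1; have := ae_integrable1 k2;
  apply: filterS2.
Qed.

Lemma Lfun2_tensor (u : T1 -> R) (v : T2 -> R) :
  u \in Lfun m1 2%:E -> v \in Lfun m2 2%:E ->
  (fun z => u z.1 * v z.2) \in Lfun (m1 \x m2)%E 2%:E.
Proof.
move=> /Lfun2P[mu_ iu] /Lfun2P[mv iv]; apply/Lfun2P; split.
  by apply: measurable_funM; [exact: (measurableT_comp mu_)|
    exact: (measurableT_comp mv)].
rewrite fubini_tonelli1//=; last 2 first.
- apply/measurable_EFinP/measurable_funX.
  by apply: measurable_funM; [exact: (measurableT_comp mu_)|
    exact: (measurableT_comp mv)].
- by move=> z; rewrite lee_fin sqr_ge0.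
rewrite /fubini_F/=.
under eq_integral => x _.
  under eq_integral do rewrite exprMn EFinM.
  rewrite ge0_integralZl//; [|exact/measurable_EFinP/measurable_funX|
    by move=> *; rewrite lee_fin sqr_ge0|by rewrite lee_fin sqr_ge0].
  over.
rewrite ge0_integralZr//; [|exact/measurable_EFinP/measurable_funX|
  by move=> *; rewrite lee_fin sqr_ge0|
  by apply: integral_ge0 => *; rewrite lee_fin sqr_ge0].
by rewrite lte_mul_pinfty// ?ge0_fin_numE ?integral_ge0// => *;
  rewrite lee_fin sqr_ge0.
Qed.

Lemma L2C_tensor (g : T1 -> R[i]) (h : T2 -> R[i]) :
  L2C m1 g -> L2C m2 h -> L2C (m1 \x m2)%E (fun z => g z.1 * (h z.2)^*).
Proof.
move=> [g1 g2] /L2CJ[h1 h2]; split.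
- under eq_fun do rewrite ReM.
  apply: Lfun2D; first exact: (Lfun2_tensor g1 h1).
  by apply: Lfun2N; exact: (Lfun2_tensor g2 h2).
- under eq_fun do rewrite ImM.
  apply: Lfun2D; first exact: (Lfun2_tensor g1 h2).
  exact: (Lfun2_tensor g2 h1).
Qed.

End Rintegral_product.

Section ae_equal.
Context (R : realType) d (T : measurableType d).
Variable mu : {measure set T -> \bar R}.

Lemma ae_filterS2 (A B C : T -> Prop) :
  (forall x, A x -> B x -> C x) ->
  {ae mu, forall x, A x} -> {ae mu, forall x, B x} -> {ae mu, forall x, C x}.
Proof. by move=> ABC; apply: filterS2. Qed.

Lemma ae_eq_cintegral (f g : T -> R[i]) : cmeasurable f -> cmeasurable g ->
  {ae mu, forall x, f x = g x} -> cintegral mu setT f = cintegral mu setT g.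
Proof.
move=> [f1 f2] [g1 g2] fg; apply: complexRI => /=; congr fine;
  by apply: ae_eq_integral => //; [exact/measurable_EFinP|
    exact/measurable_EFinP|apply: filterS fg => x /= -> _].
Qed.

Lemma cintegrable_cmeasurable (f : T -> R[i]) :
  cintegrable mu f -> cmeasurable f.
Proof.
by move=> [/measurable_int/measurable_EFinP f1 /measurable_int/measurable_EFinP f2].
Qed.

Lemma cmeasurableM (f g : T -> R[i]) : cmeasurable f -> cmeasurable g ->
  cmeasurable (fun x => f x * g x).
Proof.
move=> [f1 f2] [g1 g2]; split.
- by under eq_fun do rewrite ReM; apply: measurable_funB; exact: measurable_funM.
- by under eq_fun do rewrite ImM; apply: measurable_funD; exact: measurable_funM.
Qed.

Lemma cmeasurable_comp d' (T' : measurableType d') (f : T -> R[i])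
    (phi : T' -> T) :
  cmeasurable f -> measurable_fun setT phi -> cmeasurable (f \o phi).
Proof.
by move=> [f1 f2] mphi; split; [exact: (measurableT_comp f1)|
  exact: (measurableT_comp f2)].
Qed.

End ae_equal.

Section finite_measures.
Context (R : realType) d (T : measurableType d).
Variable mu : {finite_measure set T -> \bar R}.

Lemma L2C_cst (c : R[i]) : L2C mu (fun=> c).
Proof. by split; exact: (Lfun_cst mu). Qed.

End finite_measures.

(** * Integral operators with square-integrable kernels *)

Section integral_operators.
Context (R : realType).
Local Notation m := (mu01 R).
Local Notation mm := (mu01 R \x mu01 R)%E.
Implicit Types (k : R * R -> R[i]) (f g h : R -> R[i]).

(** The kernel of the rank-one operator taking u to <u, h> g; pairing a kernel with it yields the
    sesquilinear form of the integral operator. *)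
Definition tensor g h : R * R -> R[i] := fun z => g z.1 * (h z.2)^*.

Lemma L2C_tensorE g h : L2C m g -> L2C m h -> L2C mm (tensor g h).
Proof. exact: L2C_tensor. Qed.

Lemma L2C_snd h : L2C m h -> L2C mm (fun z => h z.2).
Proof.
move=> L2h; have := L2C_tensor (L2C_cst m 1) (L2CJ L2h).
by under eq_fun do rewrite conjCK mul1r.
Qed.

(** Cauchy-Schwarz on each section bounds the value at x by the norm of k(x, .) times the norm of
    [h], and Tonelli integrates the square of this bound. Measurability comes from Fubini, as k(x,
    y) h(y) is integrable on the square. *)
Lemma L2C_integral_op k h : L2C mm k -> L2C m h -> L2C m (integral_op k h).
Proof.
move=> L2k L2h; have mk := L2C_measurable L2k; have mh := L2C_measurable L2h.
have ikh : cintegrable mm (fun z => k z * h z.2).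
  by apply: L2CM_integrable => //; exact: L2C_snd.
have mk1 x : cmeasurable (fun y : measurableTypeR R => k (x, y)).
  exact: (cmeasurable_comp mk).
have main (u : R -> R) : measurable_fun setT (u : measurableTypeR R -> R) ->
    (forall x, (`|u x|%:E <= L2norm m (fun y => k (x, y)) * L2norm m h)%E) ->
    u \in Lfun m 2%:E.
  move=> mu_ ub; apply/Lfun2P; split => //.
  have mF : measurable_fun setT
      (fubini_F m (fun z => (Normc.normc (k z) ^+ 2)%:E)).
    apply: measurable_fun_fubini_tonelli_F.
      by apply/measurable_EFinP/measurable_funX; exact: measurable_normc.
    by move=> z; rewrite lee_fin sqr_ge0.
  apply: (@le_lt_trans _ _ (\int[m]_x (fubini_F m
      (fun z => (Normc.normc (k z) ^+ 2)%:E) x * (sqnorm m h)%:E))%E).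
    apply: ge0_le_integral => //.
    - by move=> x _; rewrite lee_fin sqr_ge0.
    - exact/measurable_EFinP/measurable_funX.
    - exact: emeasurable_funM.
    - move=> x _; have u0 : (0 <= `|u x|%:E)%E by rewrite lee_fin.
      have := lee_pmul u0 u0 (ub x) (ub x).
      rewrite -EFinM -expr2 real_normK ?num_real// muleACA.
      by rewrite /fubini_F -L2norm_sqr -L2norm_sqrE.
  rewrite ge0_integralZr//.
  + rewrite -fubini_tonelli1//.
    * by rewrite -L2norm_sqr L2norm_sqrE// -EFinM ltry.
    * by apply/measurable_EFinP/measurable_funX; exact: measurable_normc.
    * by move=> z; rewrite lee_fin sqr_ge0.
  + by move=> x _; apply: integral_ge0 => *; rewrite lee_fin sqr_ge0.
  + by rewrite lee_fin sqnorm_ge0.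
have [F1 F2] := cintegrable_cmeasurable (cintegrable1 ikh).
split; apply: main => // x.
- exact: normr_Re_cintegral_le.
- exact: normr_Im_cintegral_le.
Qed.

Lemma inner_integral_op k g h : L2C mm k -> L2C m g -> L2C m h ->
  inner (integral_op k h) g = cinner mm k (tensor g h).
Proof.
move=> L2k L2g L2h.
have ikh : cintegrable mm (fun z => k z * h z.2).
  by apply: L2CM_integrable => //; exact: L2C_snd.
have ik : cintegrable mm (fun z => k z * (tensor g h z)^*).
  by apply: L2CM_integrable => //; apply: L2CJ; exact: L2C_tensorE.
rewrite innerE /cinner -[RHS]cintegral_prod1//; apply: ae_eq_cintegral.
- apply: cmeasurableM.
    exact: L2C_measurable (L2C_integral_op L2k L2h).
  exact: L2C_measurable (L2CJ L2g).
- exact: cintegrable_cmeasurable (cintegrable1 ik).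
(* The factor conj g(x) may enter the inner integral only where the section of k(x, y) h(y) is
   integrable, which is almost everywhere. *)
- have := ae_cintegrable1 ikh; apply: filterS => x /= ix.
  rewrite mulrC -cintegralZ//; apply: eq_cintegral => y.
  by rewrite /tensor /= conjcM conjCK; ring.
Qed.

End integral_operators.

(* The library registers mu \x mu as a measure but not as a sigma-finite one,
   which Fubini on Omega * (T * T) requires. *)
Section square_measure.
Context (R : realType) d (T : measurableType d).
Variable mu : {finite_measure set T -> \bar R}.

Definition sqr_measure : set (T * T) -> \bar R := (mu \x mu)%E.

HB.instance Definition _ := Measure.copy sqr_measure (mu \x mu)%E.

Lemma sqr_measure_fin : fin_num_fun sqr_measure.
Proof.
move=> A mA; rewrite ge0_fin_numE//.
apply: (@le_lt_trans _ _ (sqr_measure setT)).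
  by apply: le_measure; rewrite ?inE.
rewrite -setXTT [ltLHS]product_measure1E// lte_mul_pinfty// ?fin_num_measure//.
by rewrite -ge0_fin_numE// fin_num_measure.
Qed.

HB.instance Definition _ :=
  Measure_isFinite.Build _ _ _ sqr_measure sqr_measure_fin.

Lemma sqr_tonelli (f : T * T -> \bar R) :
  measurable_fun setT f -> (forall z, 0 <= f z)%E ->
  (\int[sqr_measure]_z f z = \int[mu]_x \int[mu]_y f (x, y))%E.
Proof. exact: fubini_tonelli1. Qed.

Lemma cintegral_sqr (k : T * T -> R[i]) : cintegrable sqr_measure k ->
  cintegral mu setT (fun x => cintegral mu setT (fun y => k (x, y))) =
  cintegral sqr_measure setT k.
Proof. exact: cintegral_prod1. Qed.

End square_measure.

(** * Positivity of the spectral density operator *)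

Section diagonal_products.
Context (R : realType) d1 d2 (T1 : measurableType d1) (T2 : measurableType d2).
Variables (m1 : {finite_measure set T1 -> \bar R})
  (m2 : {finite_measure set T2 -> \bar R}).
Local Notation m12 := (m1 \x m2)%E.
Local Notation m122 := (m1 \x sqr_measure m2)%E.
Implicit Types (u : T1 * T2 -> R) (Y Z : T1 * T2 -> R[i]).

Lemma ae_prod (A : T1 -> Prop) (B : T2 -> Prop) :
  {ae m1, forall x, A x} -> {ae m2, forall y, B y} ->
  {ae m12, forall z, A z.1 /\ B z.2}.
Proof.
move=> [N1 [mN1 N10 AN1]] [N2 [mN2 N20 BN2]].
exists ((N1 `*` setT) `|` (setT `*` N2)); split.
- by apply: measurableU; exact: measurableX.
- apply: null_set_setU; try exact: measurableX.
  + by rewrite [LHS]product_measure1E// [X in (X * _)%E]N10 mul0e.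
  + by rewrite [LHS]product_measure1E// [X in (_ * X)%E]N20 mule0.
- move=> z /= /not_andP[nA|nB]; [left|right]; split => //=.
  + exact: AN1.
  + exact: BN2.
Qed.

(** The added variable multiplies the integral of the square by the total mass of [m2], which is
    finite; likewise in [Lfun2_snd]. *)
Lemma Lfun2_fst u : u \in Lfun m12 2%:E ->
  (fun w => u (w.1, w.2.1)) \in Lfun m122 2%:E.
Proof.
move=> /Lfun2P[mu_ iu]; apply/Lfun2P.
have mphi : measurable_fun [set: T1 * (T2 * T2)] (fun w => (w.1, w.2.1)).
  by apply: measurable_fun_pair => //; exact: measurableT_comp.
have m2u : measurable_fun setT (fun z => (u z ^+ 2)%:E).
  exact/measurable_EFinP/measurable_funX.
split; first exact: (measurableT_comp mu_).
rewrite fubini_tonelli1//=; last 2 first.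
- exact: (measurableT_comp m2u mphi).
- by move=> z; rewrite lee_fin sqr_ge0.
rewrite /fubini_F/=.
under eq_integral => x _.
  rewrite sqr_tonelli//=; last 2 first.
  - apply: (measurableT_comp m2u); apply: measurable_fun_pair => //.
  - by move=> z; rewrite lee_fin sqr_ge0.
  under eq_integral do rewrite integral_cst//.
  rewrite ge0_integralZr//; last 2 first.
  - by apply: (measurableT_comp m2u); exact: pair1_measurable.
  - by move=> *; rewrite lee_fin sqr_ge0.
  over.
rewrite ge0_integralZr//; last 2 first.
- apply: (measurable_fun_fubini_tonelli_F (fun z => (u z ^+ 2)%:E)) => //.
  by move=> z; rewrite lee_fin sqr_ge0.
- by move=> x _; apply: integral_ge0 => *; rewrite lee_fin sqr_ge0.
have := fubini_tonelli1 (m1 := m1) (m2 := m2) _ m2u.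
rewrite /fubini_F => <-; last by move=> z; rewrite lee_fin sqr_ge0.
by rewrite lte_mul_pinfty ?ge0_fin_numE ?integral_ge0//
  -?ge0_fin_numE ?fin_num_measure// => *; rewrite lee_fin sqr_ge0.
Qed.

Lemma Lfun2_snd u : u \in Lfun m12 2%:E ->
  (fun w => u (w.1, w.2.2)) \in Lfun m122 2%:E.
Proof.
move=> /Lfun2P[mu_ iu]; apply/Lfun2P.
have mphi : measurable_fun [set: T1 * (T2 * T2)] (fun w => (w.1, w.2.2)).
  by apply: measurable_fun_pair => //; exact: measurableT_comp.
have m2u : measurable_fun setT (fun z => (u z ^+ 2)%:E).
  exact/measurable_EFinP/measurable_funX.
split; first exact: (measurableT_comp mu_).
rewrite fubini_tonelli1//=; last 2 first.
- exact: (measurableT_comp m2u mphi).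
- by move=> z; rewrite lee_fin sqr_ge0.
rewrite /fubini_F/=.
under eq_integral => x _.
  rewrite sqr_tonelli//=; last 2 first.
  - apply: (measurableT_comp m2u); apply: measurable_fun_pair => //.
  - by move=> z; rewrite lee_fin sqr_ge0.
  rewrite integral_cst//.
  over.
rewrite ge0_integralZr//; last 2 first.
- apply: (measurable_fun_fubini_tonelli_F (fun z => (u z ^+ 2)%:E)) => //.
  by move=> z; rewrite lee_fin sqr_ge0.
- by move=> x _; apply: integral_ge0 => *; rewrite lee_fin sqr_ge0.
have := fubini_tonelli1 (m1 := m1) (m2 := m2) _ m2u.
rewrite /fubini_F => <-; last by move=> z; rewrite lee_fin sqr_ge0.
by rewrite lte_mul_pinfty ?ge0_fin_numE ?integral_ge0//
  -?ge0_fin_numE ?fin_num_measure// => *; rewrite lee_fin sqr_ge0.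
Qed.

(** A tensor product whose two factors share the first coordinate. When that coordinate is the
    random outcome, integrating over it produces a cross-moment kernel. *)
Definition diag_tensor Y Z : T1 * (T2 * T2) -> R[i] :=
  fun w => Y (w.1, w.2.1) * (Z (w.1, w.2.2))^*.

Lemma cintegrable_diag_tensor Y Z : L2C m12 Y -> L2C m12 Z ->
  cintegrable m122 (diag_tensor Y Z).
Proof.
move=> [Y1 Y2] /L2CJ[Z1 Z2].
apply: (@L2CM_integrable _ _ _ m122 (fun w => Y (w.1, w.2.1))
  (fun w => (Z (w.1, w.2.2))^*)); split.
- exact: Lfun2_fst Y1.
- exact: Lfun2_fst Y2.
- exact: Lfun2_snd Z1.
- exact: Lfun2_snd Z2.
Qed.

(** Both measures are finite, so the constant 1 is square-integrable and can be paired with [Z]. *)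
Lemma L2C_prod_integrable Z : L2C m12 Z -> cintegrable m12 Z.
Proof.
move=> L2Z; have := L2CM_integrable L2Z
  (L2C_tensor (L2C_cst m1 1) (L2C_cst m2 1)).
by under eq_fun do rewrite conjC1 !mulr1.
Qed.

(* The inner double integral is |\int Z(w, .)|^2. *)
Lemma cintegral_diag_tensor_ge0 Z : L2C m12 Z ->
  0 <= complex.Re (cintegral m122 setT (diag_tensor Z Z)) /\
  complex.Im (cintegral m122 setT (diag_tensor Z Z)) = 0.
Proof.
move=> L2Z; have iZ := L2C_prod_integrable L2Z.
have iZZ := cintegrable_diag_tensor L2Z L2Z.
pose a x := cintegral m2 setT (fun y => Z (x, y)).
have ia : cintegrable m1 a := cintegrable1 iZ.
have ma := cintegrable_cmeasurable ia.
have maa : cmeasurable (fun x => a x * (a x)^*).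
  apply: cmeasurableM => //.
  exact: cintegrable_cmeasurable (cintegrableJ ia).
have -> : cintegral m122 setT (diag_tensor Z Z) =
    cintegral m1 setT (fun x => a x * (a x)^*).
  rewrite -cintegral_prod1//; apply: ae_eq_cintegral => //.
    exact: cintegrable_cmeasurable (cintegrable1 iZZ).
  have := ae_cintegrable1 iZZ; have := ae_cintegrable1 iZ.
  apply: filterS2 => x /= iZx iZZx.
  rewrite -cintegral_sqr//= /diag_tensor/=.
  transitivity (cintegral m2 setT (fun y => (a x)^* * Z (x, y))).
    apply: eq_cintegral => y; rewrite cintegralZ; last exact: cintegrableJ.
    by rewrite cintegralJ// mulrC.
  by rewrite cintegralZ// mulrC.
split; first exact: sqnorm_ge0.
exact: Im_cinner_diag.
Qed.

End diagonal_products.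

(** * The combinatorics of Fejer sums *)

Section Fejer_sums.

(** Enlarging the square of indices by one adds a row and a column at index N, whose differences run
    exactly once through -N, ..., N. *)
Lemma sum_symsum (V : zmodType) (a : int -> V) N :
  \sum_(n < N) symsum a n =
  \sum_(s < N) \sum_(u < N) a (s%:Z - u%:Z).
Proof.
elim: N => [|N IH]; first by rewrite !big_ord0.
rewrite big_ord_recr/= IH [RHS]big_ord_recr/=.
under [in RHS]eq_bigr do rewrite big_ord_recr/=.
rewrite big_split/= -addrA; congr (_ + _).
rewrite /symsum -[N.*2.+1]/((N.*2).+1) -addnn -addnS big_split_ord/=.
congr (_ + _).
(* The column has supplied the negative differences; the row, read backwards, supplies 0, ..., N. *)
rewrite [RHS](reindex_inj rev_ord_inj)/=; apply: eq_bigr => j _; congr (a _).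
have jN : (j <= N)%N by rewrite -ltnS.
by rewrite subSS -(subzn jN) PoszD opprB addrAC subrr add0r addrCA subrr addr0.
Qed.

End Fejer_sums.

Section limits.
Context (R : realType).

Lemma Rintegral_indic_cvg d (T : measurableType d)
    (mu : {measure set T -> \bar R}) (k : T -> R) (D : nat -> set T) :
  mu.-integrable setT (EFin \o k) -> (forall n, measurable (D n)) ->
  {ae mu, forall x, \forall n \near \oo, D n x} ->
  \int[mu]_x (\1_(D n) x * k x) @[n --> \oo] --> \int[mu]_x k x.
Proof.
move=> ik mD Dx; have mk := measurable_int _ ik.
have mDk n : measurable_fun setT (fun x => (\1_(D n) x * k x)%:E).
  by apply/measurable_EFinP/measurable_funM => //; exact/measurable_EFinP.
apply: fine_cvg; rewrite fineK; last exact: (integrable_fin_num measurableT ik).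
have [//|||_ _] := @dominated_convergence _ _ _ mu setT measurableT
  (fun n x => (\1_(D n) x * k x)%:E) (EFin \o k) (abse \o (EFin \o k)) mDk mk.
- apply: filterS Dx => x Dx _; apply: cvg_near_cst.
  by apply: filterS Dx => n Dnx; rewrite indicE mem_set// mul1r.
- exact: integrable_abse.
- apply: nearW => x n _ /=; rewrite lee_fin normrM indicE.
  by case: (_ \in _); rewrite ?normr1 ?mul1r// normr0 mul0r.
- exact.
Qed.

(** Moment hypotheses concern tau in [0,1] only, whereas [mu01] is a measure on the whole line. *)
Lemma ae_itv01 : {ae mu01 R, forall x, 0 <= x <= 1}.
Proof.
exists (~` `[0, 1]%classic); split.
- by apply: measurableC; exact: measurable_itv.
- by rewrite /mu01 /mfrestr /mrestr /= setICl measure0.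
- by move=> x /= nx; rewrite in_itv.
Qed.

End limits.

(** * Second moments of processes and truncation *)

Section second_moments.
Context (R : realType) d (Omega : measurableType d) (P : probability Omega R).
Local Notation m := (mu01 R).
Local Notation mm := (mu01 R \x mu01 R)%E.
Local Notation mR := (measurableTypeR R).
Local Notation PT := (P \x mu01 R)%E.
Local Notation PTT := (P \x sqr_measure (mu01 R))%E.
Implicit Types (x : Omega * mR -> R) (D : set mR) (b : R -> R) (h : R -> R[i]).

(** Integrating over Omega first turns the square into a second moment, at most M on D, so M times
    the integral of b^2 is a bound. *)
Lemma Lfun2_truncate x D (M : R) b :
  measurable_fun setT x -> measurable D -> 0 <= M ->
  (forall tau, D tau -> \int[P]_w (x (w, tau) ^+ 2)%:E <= M%:E)%E ->
  b \in Lfun m 2%:E ->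
  (fun z => x z * (\1_D z.2 * b z.2)) \in Lfun PT 2%:E.
Proof.
move=> mx mD M0 xM /Lfun2P[mb ib]; apply/Lfun2P.
have mDb : measurable_fun setT (fun tau : mR => \1_D tau * b tau).
  by apply: measurable_funM.
have mf : measurable_fun setT (fun z : Omega * mR => x z * (\1_D z.2 * b z.2)).
  by apply: measurable_funM => //; exact: (measurableT_comp mDb measurable_snd).
split => //.
have mf2 : measurable_fun setT
    (fun z : Omega * mR => ((x z * (\1_D z.2 * b z.2)) ^+ 2)%:E).
  exact/measurable_EFinP/measurable_funX.
rewrite fubini_tonelli2//; last by move=> z; rewrite lee_fin sqr_ge0.
apply: (@le_lt_trans _ _ (\int[m]_tau (M%:E * (b tau ^+ 2)%:E))%E).
  apply: ge0_le_integral => //.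
  - by move=> tau _; apply: integral_ge0 => *; rewrite lee_fin sqr_ge0.
  - apply: measurable_fun_fubini_tonelli_G => //.
    by move=> z; rewrite lee_fin sqr_ge0.
  - apply: emeasurable_funM => //; exact/measurable_EFinP/measurable_funX.
  - move=> tau _; rewrite /fubini_G/=.
    under eq_integral do rewrite exprMn EFinM.
    rewrite ge0_integralZr//; last 3 first.
    + apply/measurable_EFinP/measurable_funX.
      exact: (measurableT_comp mx (pair2_measurable tau)).
    + by move=> *; rewrite lee_fin sqr_ge0.
    + by rewrite lee_fin sqr_ge0.
    rewrite indicE; have [tD|_] := boolP (tau \in D).
      rewrite mul1r lee_wpmul2r ?lee_fin ?sqr_ge0//.
      by apply: xM; rewrite inE in tD.
    by rewrite mul0r expr0n mule0 -EFinM lee_fin mulr_ge0 ?sqr_ge0.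
rewrite ge0_integralZl//.
- by rewrite lte_mul_pinfty.
- exact/measurable_EFinP/measurable_funX.
- by move=> *; rewrite lee_fin sqr_ge0.
Qed.

(** The integrand of <x, h>: integrating out the second variable leaves a random scalar. *)
Definition paired x h : Omega * mR -> R[i] := fun z => (x z)%:C%C * (h z.2)^*.

Definition truncate D h : R -> R[i] := fun tau => (\1_D tau)%:C%C * h tau.

Lemma L2C_truncate D h : measurable D -> L2C m h -> L2C m (truncate D h).
Proof.
move=> mD L2h; have [h1 h2] := L2h; have [mh1 mh2] := L2C_measurable L2h.
have main b : b \in Lfun m 2%:E -> (fun tau : mR => \1_D tau * b tau) \in Lfun m 2%:E.
  move=> /Lfun2P[mb ib]; apply/Lfun2P; split; first exact: measurable_funM.
  apply: le_lt_trans ib; apply: ge0_le_integral => //.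
  - by move=> *; rewrite lee_fin sqr_ge0.
  - by apply/measurable_EFinP/measurable_funX/measurable_funM.
  - exact/measurable_EFinP/measurable_funX.
  - move=> tau _; rewrite lee_fin indicE; case: (_ \in _); rewrite ?mul1r//.
    by rewrite mul0r expr0n sqr_ge0.
split; rewrite /truncate.
- under eq_fun do rewrite ReM /= mul0r subr0; exact: main h1.
- under eq_fun do rewrite ImM /= mul0r addr0; exact: main h2.
Qed.

Lemma L2C_paired_truncate x D (M : R) h :
  measurable_fun setT x -> measurable D -> 0 <= M ->
  (forall tau, D tau -> \int[P]_w (x (w, tau) ^+ 2)%:E <= M%:E)%E ->
  L2C m h -> L2C PT (paired x (truncate D h)).
Proof.
move=> mx mD M0 xM [h1 h2]; rewrite /paired /truncate; split.
- under eq_fun do rewrite !parts /= !mul0r !subr0.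
  exact: (Lfun2_truncate mx mD M0 xM h1).
- under eq_fun do rewrite !parts /= !mul0r !addr0 mulrN.
  by apply: Lfun2N; exact: (Lfun2_truncate mx mD M0 xM h2).
Qed.

Lemma cinner_moment_kernel x y (k : R * R -> R) h :
  (forall tau, 0 <= tau <= 1 -> (fun w => x (w, tau)) \in Lfun P 2%:E) ->
  (forall tau, 0 <= tau <= 1 -> (fun w => y (w, tau)) \in Lfun P 2%:E) ->
  k \in Lfun mm 2%:E ->
  {ae mm, forall z : R * R,
    ('E_P[(fun w => x (w, z.1) * y (w, z.2))%R] = (k z)%:E)%E} ->
  L2C m h -> L2C PT (paired x h) -> L2C PT (paired y h) ->
  cinner mm (fun z => (k z)%:C%C) (tensor h h) =
  cintegral PTT setT (diag_tensor (paired x h) (paired y h)).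
Proof.
move=> L2x L2y L2k kE L2h L2xh L2yh.
have iD := cintegrable_diag_tensor L2xh L2yh.
rewrite -cintegral_prod2//; apply: ae_eq_cintegral.
- apply: cmeasurableM.
    by split; [exact: Lfun2_measurable L2k|exact: measurable_cst].
  by apply: L2C_measurable; apply: L2CJ; exact: L2C_tensorE.
- exact: cintegrable_cmeasurable (cintegrable2 iD).
(* The moment identity holds for almost every z; restricting z to the unit square as well makes the
   product of the two variables integrable over Omega. *)
- apply: (ae_filterS2 (mu := sqr_measure m) _ kE
    (ae_prod (ae_itv01 R) (ae_itv01 R))) => z kz [z1 z2].
  have ixy : cintegrable P (fun w => (x (w, z.1) * y (w, z.2))%:C%C).
    split; last exact: integrable0.
    by apply: (Lfun2M_integrable (L2x _ z1) (L2y _ z2)).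
  have -> : (k z)%:C%C =
      cintegral P setT (fun w => (x (w, z.1) * y (w, z.2))%:C%C).
    apply: complexRI => /=; last by rewrite /Rintegral integral0.
    by rewrite /Rintegral; move: kz; rewrite unlock => ->.
  rewrite mulrC -cintegralZ//; apply: eq_cintegral => w.
  rewrite /diag_tensor /paired /tensor /=.
  rewrite !conjcM !conjCK rmorphM/=.
  have -> : ((y (w, z.2))%:C%C)^* = (y (w, z.2))%:C%C :> R[i].
    by apply: complexRI; rewrite !parts /= ?oppr0.
  by ring.
Qed.

End second_moments.

Section Fejer_kernel.
Context (R : realType) d (Omega : measurableType d) (P : probability Omega R).
Local Notation m := (mu01 R).
Local Notation mm := (mu01 R \x mu01 R)%E.
Local Notation mR := (measurableTypeR R).
Local Notation PT := (P \x mu01 R)%E.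
Local Notation PTT := (P \x sqr_measure (mu01 R))%E.
Implicit Types (D : set mR) (h : R -> R[i]).

Lemma cisD (a b : R) : cis (a + b) = cis a * cis b.
Proof. by apply: complexRI; rewrite !parts /= ?cosD ?sinD 1?addrC. Qed.

Lemma cisN (a : R) : cis (- a) = (cis a)^*.
Proof. by apply: complexRI; rewrite !parts /= ?cosN ?sinN. Qed.

Variables (xi : int -> Omega * mR -> R) (r : int -> R * R -> R) (omega : R).
Hypothesis mxi : forall t, measurable_fun setT (xi t).
Hypothesis L2xi : forall t tau, 0 <= tau <= 1 ->
  (fun w => xi t (w, tau)) \in Lfun P 2%:E.
Hypothesis L2r : forall t, r t \in Lfun mm 2%:E.
Hypothesis rE : forall t s, {ae mm, forall z : R * R,
  ('E_P[(fun w => xi (t + s) (w, z.1) * xi s (w, z.2))%R] = (r t z)%:E)%E}.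

Definition spectral_term (z : R * R) (t : int) : R[i] :=
  cis (- (omega * t%:~R)) * (r t z)%:C%C.

(** 2 pi N times the N-th Fejer mean of the spectral series, kept as a double sum because that form
    factors. *)
Definition Fejer_kernel N (z : R * R) : R[i] :=
  \sum_(s < N) \sum_(u < N) spectral_term z (s%:Z - u%:Z).

Lemma L2C_autocovariance t : L2C mm (fun z => (r t z)%:C%C).
Proof. by split; [exact: L2r|exact: (L2C0 mm).1]. Qed.

Lemma L2C_spectral_term t : L2C mm (spectral_term^~ t).
Proof. by apply: L2CZ; exact: L2C_autocovariance. Qed.

Lemma L2C_Fejer N : L2C mm (Fejer_kernel N).
Proof. by do 2 (apply: L2C_sum => ?); exact: L2C_spectral_term. Qed.

(** By [rE] with lag s - u and shift u, the kernel at lag s - u is the cross moment of [xi s] and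
    [xi u]. The phase splits as cis(- omega s) times the conjugate of cis(- omega u), so both
    indices separate. *)
Lemma cinner_Fejer N h : L2C m h -> (forall t : 'I_N, L2C PT (paired (xi t) h)) ->
  cinner mm (Fejer_kernel N) (tensor h h) =
  cintegral PTT setT
    (let Z w := \sum_(s < N) cis (- (omega * s%:R)) * paired (xi s) h w in
     diag_tensor Z Z).
Proof.
move=> L2h L2Y; have L2T := L2C_tensorE L2h L2h.
have iD (s u : 'I_N) := cintegrable_diag_tensor (L2Y s) (L2Y u).
have -> : cinner mm (Fejer_kernel N) (tensor h h) =
    \sum_(s < N) \sum_(u < N) cintegral PTT setT (fun w =>
      cis (- (omega * (s%:Z - u%:Z)%:~R)) *
      diag_tensor (paired (xi s) h) (paired (xi u) h) w).
  rewrite cinner_suml//; last first.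
    by move=> s; apply: L2C_sum => u; exact: L2C_spectral_term.
  apply: eq_bigr => s _; rewrite cinner_suml//; last first.
    by move=> u; exact: L2C_spectral_term.
  apply: eq_bigr => u _.
  rewrite cinnerZl//; last exact: L2C_autocovariance.
  rewrite cintegralZ//; congr (_ * _).
  apply: cinner_moment_kernel => //; try exact: L2xi.
  by have := rE (s%:Z - u%:Z) u; rewrite subrK.
transitivity (cintegral PTT setT (fun w => \sum_(s < N) \sum_(u < N)
    cis (- (omega * (s%:Z - u%:Z)%:~R)) *
    diag_tensor (paired (xi s) h) (paired (xi u) h) w)).
  rewrite cintegral_sum//; last first.
    by move=> s; apply: cintegrable_sum => u; exact: cintegrableZ.
  apply: eq_bigr => s _; rewrite cintegral_sum// => u.
  exact: cintegrableZ.
apply: eq_cintegral => w; rewrite /diag_tensor mulr_suml.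
apply: eq_bigr => s _; rewrite conj_sum mulr_sumr; apply: eq_bigr => u _.
rewrite intrB mulrBr opprB addrC cisD -[cis (omega * _)]conjCK -cisN.
by rewrite [in RHS]conjcM; ring.
Qed.

Lemma Fejer_truncate_ge0 N D (M : R) h : measurable D -> 0 <= M ->
  (forall (t : 'I_N) tau, D tau ->
    \int[P]_w (xi t (w, tau) ^+ 2)%:E <= M%:E)%E ->
  L2C m h ->
  0 <= complex.Re (cinner mm (Fejer_kernel N)
         (tensor (truncate D h) (truncate D h))) /\
  complex.Im (cinner mm (Fejer_kernel N)
         (tensor (truncate D h) (truncate D h))) = 0.
Proof.
move=> mD M0 DM L2h; have L2D := L2C_truncate mD L2h.
have L2Y (t : 'I_N) : L2C PT (paired (xi t) (truncate D h)).
  exact: (L2C_paired_truncate (mxi t) mD M0 (DM t) L2h).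
rewrite cinner_Fejer//; apply: cintegral_diag_tensor_ge0.
by apply: L2C_sum => s; exact: L2CZ.
Qed.

(* The second moment of X_t(tau) is finite for each tau but need not be
   integrable in tau, hence the truncation to the sets where it is bounded. *)
Lemma Fejer_ge0 N h : L2C m h ->
  0 <= complex.Re (cinner mm (Fejer_kernel N) (tensor h h)) /\
  complex.Im (cinner mm (Fejer_kernel N) (tensor h h)) = 0.
Proof.
move=> L2h; have L2T := L2C_tensorE L2h L2h.
pose V (t : nat) (tau : mR) := (\int[P]_w (xi t (w, tau) ^+ 2)%:E)%E.
have V0 t tau : (0 <= V t tau)%E.
  by apply: integral_ge0 => *; rewrite lee_fin sqr_ge0.
have mV t : measurable_fun setT (V t).
  apply: (measurable_fun_fubini_tonelli_G (fun z => (xi t z ^+ 2)%:E)).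
    exact/measurable_EFinP/measurable_funX.
  by move=> z; rewrite lee_fin sqr_ge0.
(* The sum dominates all N second moments at once and is finite on [0,1], so its sublevel sets [D n]
   bound every moment and eventually contain each point of [0,1]. *)
pose S tau := (\sum_(t < N) V t tau)%E.
have mS : measurable_fun setT S by apply: emeasurable_sum.
pose D (n : nat) := S @^-1` [set` `]-oo, n%:R%:E]].
have mD n : measurable (D n).
  by rewrite -[D n]setTI; apply: mS => //; exact: emeasurable_itv.
have DM n (t : 'I_N) tau : D n tau -> (V t tau <= n%:R%:E)%E.
  rewrite /D /= in_itv/=; apply: le_trans.
  by rewrite /S (bigD1 t)//= leeDl// sume_ge0.
have D01 tau : 0 <= tau <= 1 -> \forall n \near \oo, D n tau.
  move=> tau01; have Sfin : S tau \is a fin_num.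
    apply/sum_fin_numP => t _ _; rewrite ge0_fin_numE//.
    by have /Lfun2P[] := L2xi t tau01.
  near=> n; rewrite /D /= in_itv/= -(fineK Sfin) lee_fin.
  by near: n; exact: nbhs_infty_ger.
have pos n := Fejer_truncate_ge0 (mD n) (ler0n R n) (DM n) L2h.
pose K z := Fejer_kernel N z * (tensor h h z)^*.
have [iK1 iK2] : cintegrable mm K.
  by apply: L2CM_integrable; [exact: L2C_Fejer|exact: L2CJ].
have mDD n : measurable (D n `*` D n) by exact: measurableX.
have aeDD : {ae mm, forall z, \forall n \near \oo, (D n `*` D n) z}.
  have := ae_prod (ae_itv01 R) (ae_itv01 R).
  apply: filterS => z [z1 z2]; have := D01 _ z1; have := D01 _ z2.
  by apply: filterS2 => n Dn1 Dn2; split.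
(* Cutting [h] off in both variables multiplies the integrand by the indicator of a square, to which
   dominated convergence applies. *)
have TE n z : Fejer_kernel N z *
    (tensor (truncate (D n) h) (truncate (D n) h) z)^* =
    (\1_(D n `*` D n) z)%:C%C * K z.
  rewrite /K /tensor /truncate.
  have -> : \1_(D n `*` D n) z = \1_(D n) z.1 * \1_(D n) z.2 :> R.
    by rewrite !indicE in_setX; case: (_ \in _); rewrite ?mul1r ?mul0r.
  have rJ (a : R) : (a%:C%C)^* = a%:C%C :> R[i].
    by apply: complexRI; rewrite !parts /= ?oppr0.
  by rewrite !conjcM !conjCK !rJ rmorphM/=; ring.
have ReE n : complex.Re (cinner mm (Fejer_kernel N)
    (tensor (truncate (D n) h) (truncate (D n) h))) =
    \int[mm]_z (\1_(D n `*` D n) z * complex.Re (K z)).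
  rewrite /cinner /=; apply: eq_Rintegral => z _.
  by rewrite TE ReM /= mul0r subr0.
have ImE n : complex.Im (cinner mm (Fejer_kernel N)
    (tensor (truncate (D n) h) (truncate (D n) h))) =
    \int[mm]_z (\1_(D n `*` D n) z * complex.Im (K z)).
  rewrite /cinner /=; apply: eq_Rintegral => z _.
  by rewrite TE ImM /= mul0r addr0.
split.
- apply: (cvgr_to_ge (Rintegral_indic_cvg iK1 mDD aeDD)).
  by apply: nearW => n; rewrite -ReE; have [] := pos n.
- apply/(cvg_unique _ (Rintegral_indic_cvg iK2 mDD aeDD)) => //.
  apply: cvg_near_cst; apply: nearW => n.
  by rewrite -ImE; have [] := pos n.
Unshelve. all: by end_near. Qed.

End Fejer_kernel.

(** * Positivity and Hermitian symmetry of the spectral form *)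

Section spectral_form.
Context (R : realType) d (Omega : measurableType d) (P : probability Omega R).
Local Notation m := (mu01 R).
Local Notation mm := (mu01 R \x mu01 R)%E.
Implicit Types (f : R * R -> R[i]) (g h : R -> R[i]).

Lemma L2_autocovariance (X : int -> Omega -> L2R R) (r : int -> R * R -> R) :
  autocovariance_kernel P X r -> summable_autocovariance r ->
  forall t, r t \in Lfun mm 2%:E.
Proof.
move=> Xr rsum t; have [mr _] := Xr t.
have /summable_pinfty/(_ t I) rt : summable [set: int]
    (fun t => 'N[mm]_2%:E[EFin \o r t])%E.
  apply: le_lt_trans rsum; apply: le_esum => s _.
  by rewrite gee0_abs// Lnorm_ge0.
rewrite inE; apply/andP; rewrite !inE/=; split => //.
by rewrite gee0_abs ?Lnorm_ge0 in rt.
Qed.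

Lemma spectral_form_ge0 (X : int -> Omega -> L2R R) (r : int -> R * R -> R)
    (omega : R) f h :
  functional_time_series P X -> autocovariance_kernel P X r ->
  summable_autocovariance r -> spectral_density_kernel r omega f ->
  L2C m h ->
  0 <= complex.Re (cinner mm f (tensor h h)) /\
  complex.Im (cinner mm f (tensor h h)) = 0.
Proof.
move=> [_ mX L2X _] Xr rsum [L2f fS] L2h.
have L2r := L2_autocovariance Xr rsum.
have L2T := L2C_tensorE L2h L2h.
have L2t := L2C_spectral_term omega L2r.
pose S N z := ((2 * pi)^-1)%:C%C * symsum (spectral_term r omega z) N.
have L2S N : L2C mm (S N) by apply: L2CZ; exact: L2C_sum.
pose a N := cinner mm (S N) (tensor h h).
have [re im] := cinner_cvg0 (fun N => L2CB L2f (L2S N)) L2T fS.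
have aE N : cinner mm (fun z => f z - S N z) (tensor h h) =
    cinner mm f (tensor h h) - a N by rewrite cinnerBl.
(* [p] is the real or the imaginary part; a convergent sequence and its Cesaro means have the same
   limit. *)
have cvg_part (p : R[i] -> R) :
    (forall x y, p (x - y) = p x - p y) ->
    p (cinner mm (fun z => f z - S n z) (tensor h h)) @[n --> \oo] --> 0 ->
    arithmetic_mean (fun n => p (a n)) @ \oo --> p (cinner mm f (tensor h h)).
  move=> pB p0; apply: cesaro.
  have -> : (fun n => p (a n)) = (fun n => p (cinner mm f (tensor h h)) -
      p (cinner mm (fun z => f z - S n z) (tensor h h))).
    by apply/funext => n; rewrite aE pB subKr.
  by have := cvgB (cvg_cst (p (cinner mm f (tensor h h)))) p0; rewrite subr0; exact.
have sumE N : \sum_(0 <= n < N) a n =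
    ((2 * pi)^-1)%:C%C * cinner mm (Fejer_kernel r omega N) (tensor h h).
  have FE : Fejer_kernel r omega N =
      (fun z => \sum_(n < N) symsum (spectral_term r omega z) n).
    by apply/funext => z; rewrite sum_symsum.
  rewrite big_mkord FE cinner_suml//; last by move=> n; exact: L2C_sum.
  rewrite mulr_sumr; apply: eq_bigr => n _.
  by rewrite /a cinnerZl//; exact: L2C_sum.
have pos N := @Fejer_ge0 _ _ _ P (fun t z => X t z.1 z.2) r omega mX
  (fun t tau => L2X t tau) L2r (fun t s => (Xr t).2 s) N h L2h.
(* [arithmetic_mean] at n averages n + 1 terms, so the Fejer kernel of order n + 1 appears. *)
have meanE (p : R[i] -> R) n : arithmetic_mean (fun k => p (a k)) n =
  n.+1%:R^-1 * \sum_(0 <= k < n.+1) p (a k) by [].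
split.
- apply: (cvgr_to_ge (cvg_part _ (@ReB R) re)).
  apply: nearW => n; rewrite meanE.
  rewrite mulr_ge0// ?invr_ge0// -Re_sum sumE ReM /= mul0r subr0.
  by rewrite mulr_ge0 ?invr_ge0 ?mulr_ge0 ?pi_ge0//; have [] := pos n.+1.
- apply/(cvg_unique _ (cvg_part _ (@ImB R) im)) => //.
  apply: cvg_near_cst; apply: nearW => n; rewrite meanE.
  by rewrite -Im_sum sumE ImM (pos n.+1).2 /= mul0r mulr0 addr0 mulr0.
Qed.

Lemma tensor_polarization c g h :
  tensor (fun x => g x + c * h x) (fun x => g x + c * h x) =
  fun z => (tensor g g z + c^* * tensor g h z) +
           (c * tensor h g z + c * c^* * tensor h h z).
Proof. by apply/funext => z; rewrite /tensor !conjcD !conjcM; ring. Qed.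

Lemma integral_op_hermitian f g h : L2C mm f ->
  (forall h, L2C m h -> complex.Im (cinner mm f (tensor h h)) = 0) ->
  L2C m g -> L2C m h ->
  inner (integral_op f h) g = (inner (integral_op f g) h)^*.
Proof.
move=> L2f Im0 L2g L2h; rewrite !inner_integral_op//.
have L2T u v := @L2C_tensorE R u v.
have pol c : complex.Im (c * cinner mm f (tensor g h) +
    c^* * cinner mm f (tensor h g)) = 0.
  have := Im0 (fun x => g x + c * h x) (L2CD L2g (L2CZ c L2h)).
  rewrite tensor_polarization.
  have L2Z k u v : L2C m u -> L2C m v -> L2C mm (fun z => k * tensor u v z).
    by move=> L2u L2v; apply: L2CZ; exact: L2T.
  rewrite !cinnerDr ?cinnerZr//; try by [exact: L2T|exact: L2Z|
    apply: L2CD; [exact: L2T|exact: L2Z]|apply: L2CD; exact: L2Z].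
  rewrite conjCK ImD ImD Im0// ImD.
  have := Im0 _ L2h; set q := cinner mm f (tensor h h) => q0.
  have -> : complex.Im ((c * c^*)^* * q) = 0.
    by rewrite !parts q0; ring.
  by rewrite add0r addr0 -ImD.
(* c = 1 makes the imaginary parts of the two cross terms opposite, and c = i makes their real parts
   equal. *)
have := pol 1; have := pol 'i%C.
move: (cinner mm f _) (cinner mm f _) => a b; rewrite !parts /= => im re.
by apply: complexRI; rewrite !parts; lra.
Qed.

End spectral_form.

(** * Clipping the eigenvalues and comparing the norms *)

Lemma le_shift_max (R : realType) (nu a s : R) : 0 <= a ->
  Num.max nu 0 ^+ 2 - 2 * Num.max nu 0 * a + s <= nu ^+ 2 - 2 * nu * a + s.
Proof.
(* For nu <= 0 the left side is s, while nu^2 and - 2 nu a are both non-negative. *)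
move=> a0; have [//|nu0] := ltP 0 nu; rewrite lerD2r expr0n/= mulr0 mul0r subrr.
by rewrite subr_ge0 -mulrA (le_trans _ (sqr_ge0 nu))// pmulr_rle0 ?mulr_le0_ge0.
Qed.

Local Open Scope complex_scope.

Theorem proposition4p1 (R : realType) (d : measure_display)
    (Omega : measurableType d) (P : probability Omega R)
    (X : int -> Omega -> L2R R) (r : int -> R * R -> R)
    (hX : functional_time_series P X) (hX0 : mean_zero P X)
    (hr : autocovariance_kernel P X r) (hsum : summable_autocovariance r)
    (omega : R) (f : R * R -> R[i]) (hf : spectral_density_kernel r omega f)
    (lam : R -> R) (hlam : flat_top_function lam)
    (T : nat) (hT : (0 < T)%N) (B : R) (hB : 0 < B)
    (w : Omega) (nuhat : nat -> R) (ehat : nat -> R -> R[i])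
    (Ftilde : (R -> R[i]) -> R -> R[i]) (b : nat -> R -> R[i]) :
  let F := integral_op f in
  let Fhat :=
    integral_op (flat_top_estimator lam B T (fun t => X t w) omega) in
  spectral_decomposition Fhat nuhat ehat ->
  diagonal_op (fun j => Num.max (nuhat j) 0) ehat Ftilde ->
  orthonormal_basis b ->
  (HSnorm b (fun h tau => (Ftilde h tau - F h tau)%R)
     <= HSnorm b (fun h tau => (Fhat h tau - F h tau)%R))%E.
Proof.
move=> F Fhat [onb _ dhat] dtilde onbb.
have L2f : L2C (mu01 R \x mu01 R)%E f by case: hf.
have L2F h : L2C (mu01 R) h -> L2C (mu01 R) (F h) by exact: L2C_integral_op.
have form h := spectral_form_ge0 hX hr hsum hf (h := h).
have Fsym g h := @integral_op_hermitian _ f g h L2f (fun h L2h => (form h L2h).2).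
(* Stated for every operator diagonal in [ehat], so that it covers both [Ftilde] and [Fhat]. *)
have change_basis nu D : diagonal_op nu ehat D ->
    HSnorm b (fun h tau => (D h tau - F h tau)%R) =
    HSnorm ehat (fun h tau => (D h tau - F h tau)%R).
  move=> dD; have [L2e _ _] := onb.
  have L2D h : L2C (mu01 R) h -> L2C (mu01 R) (D h) by case/dD.
  apply: eq_HSnorm => // [h L2h|h k L2h].
    by apply: L2CB; [exact: L2D|exact: L2F].
  have [L2Dh L2Fh] := (L2D _ L2h, L2F _ L2h).
  have [L2De L2Fe] := (L2D _ (L2e k), L2F _ (L2e k)).
  (* The symmetry required by [eq_HSnorm] splits: the diagonal part has it since its eigenvalues are
     real, and [F] has it by [Fsym]. *)
  rewrite !innerE !cinnerBl// -!innerE conjcB.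
  rewrite (diagonal_op_inner _ onb dD)// (diagonal_op_basis _ onb dD)//.
  rewrite (Fsym (ehat k))// (orthonormal_basisJ onb)// conjcM conjCK.
  by congr (_ * _ - _); apply: complexRI; rewrite !parts /= ?oppr0.
rewrite (change_basis _ _ dtilde) (change_basis _ _ dhat).
apply: le_HSnorm => k; have [L2e _ _] := onb.
have [[L2tilde _] [L2hat _]] := (dtilde _ (L2e k), dhat _ (L2e k)).
have L2Fe := L2F _ (L2e k).
rewrite !L2norm_sqrE; try exact: L2CB.
rewrite lee_fin (sqnorm_diagonal_opB _ onb dtilde)//.
rewrite (sqnorm_diagonal_opB _ onb dhat)//.
(* The constant a is the real part of <F e_k, e_k>, rewritten as the pairing of [f] with the tensor
   of e_k with itself. *)
by apply: le_shift_max; rewrite inner_integral_op//; have [] := form _ (L2e k).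
Qed.
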